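(* Let $W$ be a graphon with finite diameter. Then for every chip configuration $\sigma$ on $W$ the activity $a(W,\sigma)$ exists, i.e. there is a real number $a$ such that $\lim_{n\to\infty} \frac{u_n(W,\sigma)(x)}{n}=a$ for almost every $x\in[0,1]$.
   Context: A graphon is a Lebesgue measurable symmetric function $W:[0,1]^2\to[0,1]$; $\lambda$ denotes Lebesgue measure and $\deg_W(x)=\int_0^1 W(x,y)\,dy$. A chip configuration on $W$ is an almost everywhere non-negative function $\sigma\in L^1([0,1])$. Its firing vector is $f(W,\sigma)(x)=\lfloor \sigma(x)/\deg_W(x)\rfloor$ if $\deg_W(x)>0$ and $0$ otherwise; the parallel chip-firing update is $U\sigma(x)=\sigma(x)-\deg_W(x)f(W,\sigma)(x)+\int_0^1 f(W,\sigma)(y)W(x,y)\,dy$, and $U^n$ denotes its $n$-th iterate. The odometer is $u_n(W,\sigma)(x)=\sum_{i=0}^{n-1} f(W,U^i\sigma)(x)$. For measurable $A\subseteq[0,1]$ and $\varepsilon>0$, let $\Gamma_\varepsilon(A)=\{x\in[0,1]:\int_A W(y,x)\,dy\ge\varepsilon\}$ and $\Gamma_\varepsilon^k$ its $k$-fold iterate. $W$ has finite diameter if there is $N\in\mathbb{N}$ such that for every measurable $A$ with $\lambda(A)>0$ there exists $\varepsilon>0$ with $\lambda(A\cup\Gamma_\varepsilon(A)\cup\Gamma_\varepsilon^2(A)\cup\dots\cup\Gamma^N_\varepsilon(A))=1$. *)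

(* Defs.v *)
From HB Require Import structures.
From mathcomp Require Import all_boot all_order all_algebra.
From mathcomp Require Import all_classical all_reals all_analysis.
From mathcomp Require Import measurable_realfun.

Set Implicit Arguments.
Unset Strict Implicit.
Unset Printing Implicit Defensive.

Import Order.TTheory GRing.Theory Num.Theory.
Import numFieldNormedType.Exports.

Local Open Scope classical_set_scope.
Local Open Scope ring_scope.

(* Lebesgue (not Borel) measurability is used throughout: [lebesgue_line] is
   the domain of [completed_lebesgue_measure], and [lebesgue_plane] carries the
   completion of the Borel sigma-algebra for the product measure. All functions
   live on R (resp. R * R); only their values on [0, 1] (resp. [0, 1]^2) are
   ever used. *)
Definition lebesgue_line (R : realType) : measurableType _ :=
  caratheodory_type ((@wlength R idfun)^*)%mu.

Definition lebesgue_plane (R : realType) : measurableType _ :=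
  g_sigma_algebraType (completed_algebra_gen
    ((@lebesgue_measure R) \x (@lebesgue_measure R))%E).

Section chip_firing.
Variable R : realType.

Local Notation lambda := (@completed_lebesgue_measure R).

Definition I01 : set R := `[0%R, 1%R]%classic.

Definition graphon (W : R -> R -> R) : Prop :=
  [/\ measurable_fun (I01 `*` I01 : set (lebesgue_plane R))
        (fun z : lebesgue_plane R => W z.1 z.2),
      forall x y, I01 x -> I01 y -> W x y = W y x &
      forall x y, I01 x -> I01 y -> 0 <= W x y <= 1].

Definition degree (W : R -> R -> R) (x : R) : R :=
  \int[lambda]_(y in I01) W x y.

(* An element of L^1([0, 1]) is given by an arbitrary representative. *)
Definition chip_config (sigma : R -> R) : Prop :=
  lambda.-integrable I01 (EFin \o sigma) /\
  {ae lambda, forall x, I01 x -> 0 <= sigma x}.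

Definition firing (W : R -> R -> R) (sigma : R -> R) (x : R) : R :=
  if 0 < degree W x then (Num.floor (sigma x / degree W x))%:~R else 0.

(* For a chip configuration the last integral is finite for almost every x; on
   the exceptional null set [Rintegral] returns a junk real number. *)
Definition update (W : R -> R -> R) (sigma : R -> R) (x : R) : R :=
  sigma x - degree W x * firing W sigma x
  + \int[lambda]_(y in I01) (firing W sigma y * W x y).

Definition odometer (W : R -> R -> R) (sigma : R -> R) (n : nat) (x : R) : R :=
  \sum_(0 <= i < n) firing W (iter i (update W) sigma) x.

Definition Gamma (W : R -> R -> R) (eps : R) (A : set R) : set R :=
  [set x | I01 x /\ eps <= \int[lambda]_(y in A) W y x].

Definition finite_diameter (W : R -> R -> R) : Prop :=
  exists N : nat, forall A : set R,
    measurable (A : set (lebesgue_line R)) -> A `<=` I01 ->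
    (0 < lambda A)%E ->
    exists2 eps : R, 0 < eps &
      lambda (\big[setU/set0]_(0 <= k < N.+1) iter k (Gamma W eps) A) = 1%E.

Definition is_activity (W : R -> R -> R) (sigma : R -> R) (a : R) : Prop :=
  {ae lambda, forall x, I01 x ->
    (fun n : nat => odometer W sigma n x / n%:R) @ \oo --> a}.

End chip_firing.

(* Main.v *)
(* The odometer satisfies [u_(n+1) = floor ((sigma + L u_n) / deg)] with
   [L f x = int W(x,y) f(y) dy]: a monotone map that commutes with adding integer
   constants. Hence "[u_q >= k] a.e." is superadditive in [(q, k)], and
   [a := sup k/q] bounds [liminf u_n / n] from below almost everywhere.

   For the upper bound, finite diameter forces [deg >= delta > 0] a.e.. Total mass
   is conserved, so [h_n := L u_n / deg] is [O(n)] and [deg h_n - L h_n] is [O(1)],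
   both uniformly; the Dirichlet energy [int int W(x,y) (h_n(x) - h_n(y))^2] is
   therefore [O(n)]. For [g_j := h_n / n] with [n = (j+1)^2] the energies are
   summable, so [g_j(x) - g_j(y) -> 0] for almost every pair with [W(x,y) > 0].
   The class [{y | g_j(x0) - g_j(y) -> 0}] is closed under [W]-neighbours up to null
   sets, and finite diameter makes it conull. Since [u_(n+2) >= L h_n / deg - 2] and
   [L] maps L^1 into L^oo, the common value of [g_j] is at most [a + o(1)], and
   monotonicity of [u] interpolates between consecutive squares. *)
Require Import Defs.
From HB Require Import structures.
From mathcomp Require Import all_boot all_order all_algebra.
From mathcomp Require Import all_classical all_reals all_analysis.
From mathcomp Require Import measurable_realfun.
From mathcomp Require Import lra ring.

Set Implicit Arguments.
Unset Strict Implicit.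
Unset Printing Implicit Defensive.

Import Order.TTheory GRing.Theory Num.Theory.
Import numFieldNormedType.Exports.

Local Open Scope classical_set_scope.
Local Open Scope ring_scope.

(** * Measurability and almost-everywhere comparison of real integrals *)

Lemma measurable_fun_floor d (T : measurableType d) (R : realType) (f : T -> R) :
  measurable_fun setT f ->
  measurable_fun setT (fun x => (Num.floor (f x))%:~R : R).
Proof.
move=> mf; apply: (measurableT_comp (f := fun x : R => (Num.floor x)%:~R : R)) mf.
apply: nondecreasing_measurable => // x y xy.
by rewrite ler_int le_floor.
Qed.

Lemma measurable_fun_inv_pos d (T : measurableType d) (R : realType)
    (f : T -> R) : (forall x, 0 < f x) ->
  measurable_fun setT f -> measurable_fun setT (fun x => (f x)^-1).
Proof.
move=> f0 mf; rewrite (_ : (fun x => _) = (fun x => f x `^ (-1))); last first.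
  by apply/funext => x; rewrite powR_inv1// ltW.
exact: (measurableT_comp (f := (@powR R ^~ (-1)))).
Qed.

Section Rintegral_ae.
Context d (T : measurableType d) (R : realType).
Variable mu : {measure set T -> \bar R}.
Implicit Types f g : T -> R.

Lemma ae_eq_Rintegral (D : set T) f g : measurable D ->
  measurable_fun D f -> measurable_fun D g ->
  (\forall x \ae mu, D x -> f x = g x) ->
  \int[mu]_(x in D) f x = \int[mu]_(x in D) g x.
Proof.
move=> mD mf mg fg; congr fine; apply: ae_eq_integral => //.
- exact/measurable_EFinP.
- exact/measurable_EFinP.
- by apply: filterS fg => x /[apply] ->.
Qed.

(** The pointwise comparison of integrals applies to [f] and [max f g]; the latter agrees with [g]
    almost everywhere, so it has the same integral. *)
Lemma ae_le_Rintegral f g :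
  mu.-integrable setT (EFin \o f) -> mu.-integrable setT (EFin \o g) ->
  (\forall x \ae mu, f x <= g x) -> \int[mu]_x f x <= \int[mu]_x g x.
Proof.
move=> fi gi fg.
have mf : measurable_fun setT f by exact/measurable_EFinP/(measurable_int mu).
have mg : measurable_fun setT g by exact/measurable_EFinP/(measurable_int mu).
have mm : measurable_fun setT (fun x => Num.max (f x) (g x)).
  exact: measurable_maxr.
have mi : mu.-integrable setT (EFin \o (fun x => Num.max (f x) (g x))).
  apply: (@le_integrable _ _ _ mu setT measurableT _
    (EFin \o (fun x => `|f x| + `|g x|))).
  - exact/measurable_EFinP.
  - move=> x _ /=; rewrite lee_fin (@ger0_norm _ (`|f x| + `|g x|))//.
    by rewrite /Num.max; case: ifP => _; rewrite ?lerDl ?lerDr.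
  - rewrite (_ : _ \o _ = (abse \o (EFin \o f)) \+ (abse \o (EFin \o g)))%E//.
    by apply: integrableD => //; exact: integrable_abse.
rewrite -(@ae_eq_Rintegral setT (fun x => Num.max (f x) (g x)) g)//.
  by apply: le_Rintegral => // x _; rewrite le_max lexx.
by apply: filterS fg => x fgx _; exact/max_idPr.
Qed.

Lemma le_integrable_EFin f g : measurable_fun setT f ->
  (forall x, `|f x| <= g x) ->
  mu.-integrable setT (EFin \o g) -> mu.-integrable setT (EFin \o f).
Proof.
move=> mf fg; apply: le_integrable => //; first exact/measurable_EFinP.
by move=> x _ /=; rewrite lee_fin (le_trans (fg x))// ler_norm.
Qed.

Lemma integrable_EFinD f g :
  mu.-integrable setT (EFin \o f) -> mu.-integrable setT (EFin \o g) ->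
  mu.-integrable setT (EFin \o (fun x => f x + g x)).
Proof. by move=> fi gi; exact: (integrableD measurableT fi gi). Qed.

Lemma integrable_EFinB f g :
  mu.-integrable setT (EFin \o f) -> mu.-integrable setT (EFin \o g) ->
  mu.-integrable setT (EFin \o (fun x => f x - g x)).
Proof. by move=> fi gi; exact: (integrableB measurableT fi gi). Qed.

Lemma integrable_EFinZ k f : mu.-integrable setT (EFin \o f) ->
  mu.-integrable setT (EFin \o (fun x => k * f x)).
Proof. by move=> fi; exact: (integrableZl measurableT k fi). Qed.

Lemma integral_EFin_Rintegral f : mu.-integrable setT (EFin \o f) ->
  (\int[mu]_x (f x)%:E)%E = (\int[mu]_x f x)%:E.
Proof. by move=> fi; rewrite fineK//; exact: integrable_fin_num. Qed.

Lemma measurable_integrable f :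
  mu.-integrable setT (EFin \o f) -> measurable_fun setT f.
Proof. by move=> fi; exact/measurable_EFinP/(measurable_int mu). Qed.

End Rintegral_ae.

(** * The integral operator of a symmetric kernel on a probability space *)

Section kernel_operator.
Context d (T : measurableType d) (R : realType).
Variables (P : probability T R) (W : T -> T -> R).
Hypothesis mW : measurable_fun setT (fun z : T * T => W z.1 z.2).
Hypothesis symW : forall x y, W x y = W y x.
Hypothesis W01 : forall x y, 0 <= W x y <= 1.

Definition kernel_op (f : T -> R) (x : T) : R := \int[P]_y (W x y * f y).

Definition kernel_deg (x : T) : R := \int[P]_y W x y.

Local Notation L := kernel_op.
Local Notation D := kernel_deg.
Local Notation integrable f := (P.-integrable setT (EFin \o f)).

Lemma integrable_cstR (c : R) : integrable (fun=> c).
Proof. exact: finite_measure_integrable_cst. Qed.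

Lemma Rintegral_cst_prob (c : R) : \int[P]_x c = c.
Proof. by rewrite Rintegral_cst//= probability_setT mulr1. Qed.

Lemma measurable_kernel_section x : measurable_fun setT (W x).
Proof. exact: (measurable_fun_pair2 (f := fun z : T * T => W z.1 z.2)). Qed.

Lemma kernel_norm_le x y (c : R) : `|W x y * c| <= `|c|.
Proof.
have /andP[W0 W1] := W01 x y.
by rewrite normrM ger0_norm// ler_piMl.
Qed.

Lemma integrable_kernelM x f : integrable f ->
  integrable (fun y => W x y * f y).
Proof.
move=> fi; apply: (@le_integrable_EFin _ _ _ _ _ (fun y => `|f y|)).
- apply: measurable_funM; first exact: measurable_kernel_section.
  exact: measurable_integrable fi.
- by move=> y; exact: kernel_norm_le.
- exact: integrable_abse fi.
Qed.

Lemma integrable_kernel x : integrable (W x).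
Proof.
have := @integrable_kernelM x (fun=> 1) (integrable_cstR 1).
by under [X in EFin \o X]eq_fun do rewrite mulr1.
Qed.

Lemma kernel_degE : D = L (fun=> 1).
Proof.
by apply/funext => x; apply: eq_Rintegral => y _; rewrite mulr1.
Qed.

Lemma kernel_op_ge0 f x : (forall y, 0 <= f y) -> 0 <= L f x.
Proof.
move=> f0; apply: Rintegral_ge0 => y _; apply: mulr_ge0 => //.
by have /andP[] := W01 x y.
Qed.

Lemma kernel_opD f g x : integrable f -> integrable g ->
  L (fun y => f y + g y) x = L f x + L g x.
Proof.
move=> fi gi; rewrite -RintegralD//; [|exact: integrable_kernelM..].
by apply: eq_Rintegral => y _; rewrite mulrDr.
Qed.

Lemma kernel_opB f g x : integrable f -> integrable g ->
  L (fun y => f y - g y) x = L f x - L g x.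
Proof.
move=> fi gi; rewrite -RintegralB//; [|exact: integrable_kernelM..].
by apply: eq_Rintegral => y _; rewrite mulrBr.
Qed.

Lemma kernel_opZ k f x : integrable f -> L (fun y => k * f y) x = k * L f x.
Proof.
move=> fi; rewrite -RintegralZl//; last exact: integrable_kernelM.
by apply: eq_Rintegral => y _; rewrite mulrCA.
Qed.

Lemma kernel_op_cst k x : L (fun=> k) x = k * D x.
Proof.
rewrite kernel_degE -kernel_opZ; last exact: integrable_cstR.
by apply: eq_Rintegral => y _; rewrite mulr1.
Qed.

Lemma le_kernel_op f g x : integrable f -> integrable g ->
  (\forall y \ae P, f y <= g y) -> L f x <= L g x.
Proof.
move=> fi gi fg; apply: ae_le_Rintegral; [exact: integrable_kernelM..|].
apply: filterS fg => y fgy; apply: ler_wpM2l => //.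
by have /andP[] := W01 x y.
Qed.

(** Since [W <= 1], the operator maps L^1 into L^oo with norm at most 1. Every passage from mean
    bounds to pointwise bounds rests on this. *)
Lemma kernel_op_norm_le f x : integrable f -> `|L f x| <= \int[P]_y `|f y|.
Proof.
move=> fi; apply: le_trans (le_normr_Rintegral _ (integrable_kernelM _ fi)) _ => //.
apply: le_Rintegral => //.
- exact: integrable_abse (integrable_kernelM _ fi).
- exact: integrable_abse fi.
- by move=> y _; exact: kernel_norm_le.
Qed.

Lemma kernel_deg_ge0 x : 0 <= D x.
Proof. by rewrite kernel_degE; exact: kernel_op_ge0. Qed.

Lemma kernel_deg_le1 x : D x <= 1.
Proof.
rewrite kernel_degE; apply: le_trans (ler_norm _) _.
apply: le_trans (kernel_op_norm_le _ (integrable_cstR _)) _.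
by rewrite Rintegral_cst_prob normr1.
Qed.

(** Tonelli makes the partial integral of the non-negative function [W x y * f y] measurable in
    [x]. *)
Lemma measurable_kernel_op f : (forall x, 0 <= f x) -> integrable f ->
  measurable_fun setT (L f).
Proof.
move=> f0 fi; have mf := measurable_integrable fi.
pose F (z : T * T) := (W z.1 z.2 * f z.2)%:E.
have mF : measurable_fun setT F.
  apply/measurable_EFinP; apply: measurable_funM => //.
  exact: (measurableT_comp mf).
have F0 z : (0 <= F z)%E.
  by rewrite lee_fin mulr_ge0//; have /andP[] := W01 z.1 z.2.
have := measurable_fun_fubini_tonelli_F (m2 := P) F mF F0.
exact: (measurableT_comp (fine_measurable measurableT)).
Qed.

Lemma integrable_kernel_op f : (forall x, 0 <= f x) -> integrable f ->
  integrable (L f).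
Proof.
move=> f0 fi.
apply: (@le_integrable_EFin _ _ _ _ _ (fun=> \int[P]_y `|f y|)).
- exact: measurable_kernel_op.
- by move=> x; exact: kernel_op_norm_le.
- exact: integrable_cstR.
Qed.

Lemma measurable_kernel_deg : measurable_fun setT D.
Proof.
by rewrite kernel_degE; apply: measurable_kernel_op => //; exact: integrable_cstR.
Qed.

Lemma integrable_degM f : integrable f -> integrable (fun x => D x * f x).
Proof.
move=> fi; apply: (@le_integrable_EFin _ _ _ _ _ (fun x => `|f x|)).
- apply: measurable_funM; first exact: measurable_kernel_deg.
  exact: measurable_integrable fi.
- move=> x; rewrite normrM ger0_norm ?kernel_deg_ge0//.
  by rewrite ler_piMl// kernel_deg_le1.
- exact: integrable_abse fi.
Qed.

(** Swap the integrals by Tonelli and use the symmetry of [W]. In chip-firing terms, the mass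
    received equals the mass sent, so the total is conserved. *)
Lemma Rintegral_kernel_op f : (forall x, 0 <= f x) -> integrable f ->
  \int[P]_x L f x = \int[P]_x (D x * f x).
Proof.
move=> f0 fi; have mf := measurable_integrable fi.
pose F (z : T * T) := (W z.1 z.2 * f z.2)%:E.
have mF : measurable_fun setT F.
  apply/measurable_EFinP; apply: measurable_funM => //.
  exact: (measurableT_comp mf).
have F0 z : (0 <= F z)%E.
  by rewrite lee_fin mulr_ge0//; have /andP[] := W01 z.1 z.2.
have := fubini_tonelli (m1 := P) (m2 := P) F mF F0.
rewrite /F /= => FT; congr fine.
transitivity (\int[P]_x \int[P]_y (W x y * f y)%:E)%E.
  apply: eq_integral => x _; rewrite integral_EFin_Rintegral//.
  exact: integrable_kernelM.
rewrite FT; apply: eq_integral => y _.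
have -> : D y * f y = \int[P]_x (W x y * f y).
  rewrite -RintegralZr//; last exact: integrable_kernel.
  by apply: eq_Rintegral => x _; rewrite symW.
rewrite -integral_EFin_Rintegral//.
under [X in EFin \o X]eq_fun do rewrite symW mulrC.
by apply: integrable_EFinZ; exact: integrable_kernel.
Qed.

Lemma integrable_bounded (M : R) (h : T -> R) : measurable_fun setT h ->
  (forall x, `|h x| <= M) -> integrable h.
Proof.
by move=> mh hM; apply: (le_integrable_EFin mh hM); exact: integrable_cstR.
Qed.

(* Dirichlet form of the reversible Markov operator [L / D]. *)
Lemma kernel_energyE (M : R) (h : T -> R) : measurable_fun setT h ->
  (forall x, 0 <= h x <= M) ->
  \int[P]_x L (fun y => (h x - h y) ^+ 2) x =
  2 * \int[P]_x (h x * (D x * h x - L h x)).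
Proof.
move=> mh h0M.
have h0 x : 0 <= h x by have /andP[] := h0M x.
have hM x : h x <= M by have /andP[] := h0M x.
have M0 : 0 <= M by exact: le_trans (hM point).
have hi : integrable h.
  by apply: (integrable_bounded (M := M)) => // x; rewrite ger0_norm.
have hM2 x : h x ^+ 2 <= M ^+ 2 by rewrite lerXn2r ?nnegrE.
have h20 x : 0 <= h x ^+ 2 by rewrite exprn_ge0.
have h2i : integrable (fun x => h x ^+ 2).
  apply: (integrable_bounded (M := M ^+ 2)); first exact: measurable_funX.
  by move=> x; rewrite ger0_norm.
have Lhi : integrable (L h) by exact: integrable_kernel_op.
have mLh := measurable_integrable Lhi.
have bM (f : T -> R) : integrable f -> integrable (fun x => h x * f x).
  move=> fi; apply: (@le_integrable_EFin _ _ _ _ _ (fun x => M * `|f x|)).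
  - by apply: measurable_funM => //; exact: measurable_integrable fi.
  - by move=> x; rewrite normrM (ger0_norm (h0 x)) ler_wpM2r.
  - by apply: integrable_EFinZ; exact: integrable_abse fi.
have E x : L (fun y => (h x - h y) ^+ 2) x =
    (D x * h x ^+ 2 - 2 * (h x * L h x)) + L (fun y => h y ^+ 2) x.
  transitivity (L (fun y => (h x ^+ 2 - (2 * h x) * h y) + h y ^+ 2) x).
    by apply: eq_Rintegral => y _; congr (_ * _); ring.
  rewrite kernel_opD//; last first.
    apply: integrable_EFinB; first exact: integrable_cstR.
    exact: integrable_EFinZ.
  rewrite kernel_opB ?kernel_op_cst ?kernel_opZ//.
  - by rewrite [in LHS]mulrC mulrA.
  - exact: integrable_cstR.
  - exact: integrable_EFinZ.
under eq_Rintegral do rewrite E.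
rewrite RintegralD//; last 2 first.
- apply: integrable_EFinB; first exact: integrable_degM.
  by apply: integrable_EFinZ; exact: bM.
- exact: integrable_kernel_op.
(* By symmetry the integral of [L] applied to [h ^+ 2] equals that of [D * h ^+ 2]; the two square
   terms coincide, hence the factor 2. *)
rewrite Rintegral_kernel_op// RintegralB//; last 2 first.
- exact: integrable_degM.
- by apply: integrable_EFinZ; exact: bM.
rewrite RintegralZl//; last exact: bM.
rewrite (_ : \int[P]_x (h x * (D x * h x - L h x)) =
  \int[P]_x (D x * h x ^+ 2) - \int[P]_x (h x * L h x)); first by ring.
rewrite -RintegralB//; [|exact: integrable_degM|exact: bM].
by apply: eq_Rintegral => x _; ring.
Qed.

End kernel_operator.

(** * The odometer as a monotone recursion, and its energy estimate *)

Section parallel_chip_firing.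
Context d (T : measurableType d) (R : realType).
Variables (P : probability T R) (W : T -> T -> R).
Hypothesis mW : measurable_fun setT (fun z : T * T => W z.1 z.2).
Hypothesis symW : forall x y, W x y = W y x.
Hypothesis W01 : forall x y, 0 <= W x y <= 1.
Variables (delta : R) (s : T -> R).
Hypothesis delta0 : 0 < delta.
Hypothesis degW : \forall x \ae P, delta <= kernel_deg P W x.
Hypothesis s0 : forall x, 0 <= s x.
Hypothesis si : P.-integrable setT (EFin \o s).

Local Notation L := (kernel_op P W).
Local Notation D := (kernel_deg P W).
Local Notation integrable f := (P.-integrable setT (EFin \o f)).

Definition deg_floor x := Num.max (D x) delta.

Local Notation Dd := deg_floor.

(* [Dd] agrees with the degree [D] a.e. and is bounded below everywhere. *)
Fixpoint odo (n : nat) : T -> R :=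
  if n is m.+1 then fun x => (Num.floor ((s x + L (odo m) x) / Dd x))%:~R
  else fun=> 0.

Lemma deg_floor_gt0 x : 0 < Dd x.
Proof. by rewrite lt_max delta0 orbT. Qed.

Lemma deg_floor_ge x : delta <= Dd x.
Proof. by rewrite le_max lexx orbT. Qed.

Lemma deg_le_floor x : D x <= Dd x.
Proof. by rewrite le_max lexx. Qed.

Lemma deg_floor_ae : \forall x \ae P, Dd x = D x.
Proof. by apply: filterS degW => x h; exact/max_idPl. Qed.

Lemma measurable_deg_floor : measurable_fun setT Dd.
Proof. by apply: measurable_maxr => //; exact: measurable_kernel_deg. Qed.

Lemma measurable_div_deg_floor (f : T -> R) : measurable_fun setT f ->
  measurable_fun setT (fun x => f x / Dd x).
Proof.
move=> mf; apply: measurable_funM => //.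
apply: measurable_fun_inv_pos; first exact: deg_floor_gt0.
exact: measurable_deg_floor.
Qed.

Lemma div_deg_floor_le (a : R) x : 0 <= a -> a / Dd x <= a / delta.
Proof.
move=> a0; apply: ler_wpM2l => //.
by rewrite lef_pV2 ?posrE ?deg_floor_gt0// deg_floor_ge.
Qed.

(** Non-negativity and integrability share one induction, because the measurability of [L (odo n)]
    uses both. *)
Lemma odo_facts n : [/\ forall x, 0 <= odo n x, integrable (odo n) &
  forall x, odo n x \is a Num.int].
Proof.
elim: n => [|n [u0 ui _]] /=.
  by split => //; exact: integrable_cstR.
have a0 x : 0 <= s x + L (odo n) x by rewrite addr_ge0// kernel_op_ge0.
have q0 x : 0 <= (s x + L (odo n) x) / Dd x.
  by rewrite divr_ge0// ltW// deg_floor_gt0.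
have f0 x : (0 : R) <= (Num.floor ((s x + L (odo n) x) / Dd x))%:~R.
  by rewrite ler0z floor_ge0.
split => //.
apply: (@le_integrable_EFin _ _ _ _ _
    (fun x => delta^-1 * (s x + L (odo n) x))).
- apply/measurable_fun_floor/measurable_div_deg_floor.
  apply: measurable_funD; first exact: measurable_integrable si.
  exact: measurable_kernel_op.
- move=> x; rewrite ger0_norm//; apply: le_trans (floor_le_tmp _) _.
  by rewrite [leRHS]mulrC div_deg_floor_le.
- apply: integrable_EFinZ; apply: integrable_EFinD => //.
  exact: integrable_kernel_op.
Qed.

Lemma odo_ge0 n x : 0 <= odo n x. Proof. by have [] := odo_facts n. Qed.
Lemma integrable_odo n : integrable (odo n). Proof. by have [] := odo_facts n. Qed.
Lemma odo_int n x : odo n x \is a Num.int. Proof. by have [] := odo_facts n. Qed.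

Lemma odo_leS n x : odo n x <= odo n.+1 x.
Proof.
elim: n x => [|n IH] x; first exact: odo_ge0.
rewrite [leLHS]/= [leRHS]/= ler_int le_floor//.
rewrite ler_wpM2r ?invr_ge0 ?(ltW (deg_floor_gt0 x))// lerD2l.
apply: le_kernel_op => //; last exact: aeW.
  exact: integrable_odo.
exact: (integrable_odo n.+1).
Qed.

Lemma odo_le m n x : (m <= n)%N -> odo m x <= odo n x.
Proof.
move=> /subnK <-; elim: (n - m)%N => // k IH.
by apply: le_trans IH _; rewrite addSn; exact: odo_leS.
Qed.

Lemma odoS_le n x : odo n.+1 x <= (s x + L (odo n) x) / Dd x.
Proof. exact: floor_le_tmp. Qed.

Lemma odoS_gt n x : (s x + L (odo n) x) / Dd x - 1 < odo n.+1 x.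
Proof. by rewrite ltrBlDr -(intrD _ _ 1); exact: floorD1_gt. Qed.

Let S := \int[P]_x s x.

(** Pointwise [D * odo n.+1 <= s + L (odo n)], and [L (odo n)] has the same integral as [D * odo n],
    so each step adds at most [S]. *)
Lemma Rintegral_deg_odo_le n : \int[P]_x (D x * odo n x) <= n%:R * S.
Proof.
elim: n => [|n IH].
  under eq_Rintegral do rewrite /= mulr0.
  by rewrite Rintegral_cst_prob mul0r.
apply: (@le_trans _ _ (\int[P]_x (s x + L (odo n) x))).
  apply: le_Rintegral => //.
  - by apply: integrable_degM => //; exact: integrable_odo.
  - apply: integrable_EFinD => //; apply: integrable_kernel_op => //.
      exact: odo_ge0.
    exact: integrable_odo.
  - move=> x _; apply: (@le_trans _ _ (Dd x * odo n.+1 x)).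
      by rewrite ler_wpM2r ?odo_ge0 ?deg_le_floor.
    by rewrite mulrC -ler_pdivlMr ?deg_floor_gt0// odoS_le.
have ui := integrable_odo n; have u0 := odo_ge0 n.
rewrite RintegralD//; last exact: integrable_kernel_op.
by rewrite Rintegral_kernel_op// -natr1 mulrDl mul1r addrC lerD2r.
Qed.

Lemma Rintegral_odo_le n : \int[P]_x odo n x <= n%:R * (S / delta).
Proof.
rewrite mulrA ler_pdivlMr// mulrC -RintegralZl//; last exact: integrable_odo.
apply: le_trans (Rintegral_deg_odo_le n).
apply: ae_le_Rintegral.
- by apply: integrable_EFinZ; exact: integrable_odo.
- by apply: integrable_degM => //; exact: integrable_odo.
- by apply: filterS degW => x h; rewrite ler_wpM2r ?odo_ge0.
Qed.

Lemma kernel_odo_le n x : L (odo n) x <= n%:R * (S / delta).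
Proof.
apply: le_trans (Rintegral_odo_le n); apply: le_trans (ler_norm _) _.
apply: le_trans (kernel_op_norm_le _ _ _ (integrable_odo n)) _ => //.
by under eq_Rintegral do rewrite ger0_norm ?odo_ge0//.
Qed.

(** The degree-weighted neighbour average of the odometer. Unlike [odo n], which inherits the
    possible unboundedness of [s], it is bounded everywhere by a multiple of [n]. *)
Definition odo_avg n x := L (odo n) x / Dd x.
Local Notation h := odo_avg.

Let C := S / delta / delta.

Lemma odo_avg_ge0 n x : 0 <= h n x.
Proof.
by rewrite divr_ge0 ?(ltW (deg_floor_gt0 x))// kernel_op_ge0//; exact: odo_ge0.
Qed.

Lemma odo_avg_le n x : h n x <= n%:R * C.
Proof.
rewrite mulrA; apply: (@le_trans _ _ (L (odo n) x / delta)).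
  by rewrite div_deg_floor_le// kernel_op_ge0//; exact: odo_ge0.
by rewrite ler_wpM2r ?invr_ge0 ?(ltW delta0)// kernel_odo_le.
Qed.

Lemma measurable_odo_avg n : measurable_fun setT (h n).
Proof.
apply: measurable_div_deg_floor; apply: measurable_kernel_op => //.
  exact: odo_ge0.
exact: integrable_odo.
Qed.

Lemma integrable_odo_avg n : integrable (h n).
Proof.
apply: (@integrable_bounded _ _ _ P (n%:R * C)); first exact: measurable_odo_avg.
by move=> x; rewrite ger0_norm ?odo_avg_ge0// odo_avg_le.
Qed.

(* Closed form of the configuration after [n] steps. *)
Definition chips n x := s x + L (odo n) x - D x * odo n x.

(** Chain [D * odo n <= Dd * odo n.+1 <= s + L (odo n)]: monotonicity of the odometer, then the
    floor inequality. *)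
Lemma chips_ge0 n x : 0 <= chips n x.
Proof.
rewrite subr_ge0; apply: (@le_trans _ _ (Dd x * odo n.+1 x)).
  by apply: ler_pM; rewrite ?kernel_deg_ge0 ?odo_ge0 ?deg_le_floor ?odo_leS.
by rewrite mulrC -ler_pdivlMr ?deg_floor_gt0// odoS_le.
Qed.

Lemma integrable_chips n : integrable (chips n).
Proof.
have ui := integrable_odo n; have u0 := odo_ge0 n.
apply: integrable_EFinB; last exact: integrable_degM.
by apply: integrable_EFinD => //; exact: integrable_kernel_op.
Qed.

Lemma Rintegral_chips n : \int[P]_x chips n x = S.
Proof.
have ui := integrable_odo n; have u0 := odo_ge0 n.
rewrite RintegralB//; last 2 first.
- by apply: integrable_EFinD => //; exact: integrable_kernel_op.
- exact: integrable_degM.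
rewrite RintegralD//; last exact: integrable_kernel_op.
by rewrite Rintegral_kernel_op// addrK.
Qed.

(** Where [Dd = D], the left side is [L (odo n - h n)], and [odo n - h n] equals
    [(s - chips n) / D]. Both [s] and [chips n] are non-negative with integral [S], so its L^1 norm
    is at most [2 * S / delta], and [L] turns this into a pointwise bound. *)
Lemma odo_avg_harmonic n :
  \forall x \ae P, `|D x * h n x - L (h n) x| <= 2 * S / delta.
Proof.
have ui := integrable_odo n; have u0 := odo_ge0 n.
have hi := integrable_odo_avg n.
apply: filterS deg_floor_ae => x Dx.
rewrite -{1}Dx /odo_avg (mulrC (Dd x)) divfK ?gt_eqF ?deg_floor_gt0//.
rewrite -/(h n) -kernel_opB//.
apply: le_trans (kernel_op_norm_le _ _ _ (integrable_EFinB ui hi)) _ => //.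
have gi : integrable (fun y => delta^-1 * (s y + chips n y)).
  by apply: integrable_EFinZ; apply: integrable_EFinD => //; exact: integrable_chips.
rewrite (_ : 2 * S / delta = \int[P]_y (delta^-1 * (s y + chips n y))); last first.
  rewrite RintegralZl//; last first.
    by apply: integrable_EFinD => //; exact: integrable_chips.
  rewrite RintegralD//; last exact: integrable_chips.
  by rewrite Rintegral_chips -/S; ring.
apply: ae_le_Rintegral => //.
  by have := integrable_abse (integrable_EFinB ui hi).
apply: filterS deg_floor_ae => y Dy.
have -> : odo n y - h n y = (s y - chips n y) / Dd y.
  rewrite /odo_avg -{1}(mulfK (lt0r_neq0 (deg_floor_gt0 y)) (odo n y)) -mulrBl.
  by congr (_ / _); rewrite /chips Dy; ring.
rewrite normrM normfV (gtr0_norm (deg_floor_gt0 y)) mulrC.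
apply: ler_pM => //.
- by rewrite invr_ge0 ltW// deg_floor_gt0.
- by rewrite lef_pV2 ?posrE ?deg_floor_gt0// deg_floor_ge.
- apply: le_trans (ler_normB _ _) _.
  by rewrite !ger0_norm ?chips_ge0.
Qed.

(** In the energy identity one factor [h n] is at most [n * C], while the defect [D * h n - L (h n)]
    stays bounded. The growth is thus linear in [n], although [h n ^+ 2] may grow quadratically. *)
Lemma odo_avg_energy n :
  \int[P]_x L (fun y => (h n x - h n y) ^+ 2) x <= n%:R * (4 * S * C / delta).
Proof.
rewrite (@kernel_energyE _ _ _ _ _ mW symW W01 (n%:R * C)); last 2 first.
- exact: measurable_odo_avg.
- by move=> x; rewrite odo_avg_ge0 odo_avg_le.
rewrite (_ : n%:R * _ = 2 * (n%:R * C * (2 * S / delta))); last by ring.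
rewrite ler_pM2l// -[leRHS](Rintegral_cst_prob P).
have C0 : 0 <= n%:R * C := le_trans (odo_avg_ge0 n point) (odo_avg_le n point).
have hi := integrable_odo_avg n.
have Fi : integrable (fun x => D x * h n x - L (h n) x).
  apply: integrable_EFinB; first exact: integrable_degM.
  by apply: integrable_kernel_op => //; exact: odo_avg_ge0.
apply: ae_le_Rintegral; last first.
- apply: filterS (odo_avg_harmonic n) => x Hx.
  apply: (@le_trans _ _ (h n x * (2 * S / delta))).
    by rewrite ler_wpM2l ?odo_avg_ge0// (le_trans (ler_norm _)).
  by rewrite ler_wpM2r ?odo_avg_le// (le_trans _ Hx).
- exact: integrable_cstR.
apply: (@le_integrable_EFin _ _ _ _ _
  (fun x => (n%:R * C) * `|D x * h n x - L (h n) x|)).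
- apply: measurable_funM; first exact: measurable_odo_avg.
  exact: measurable_integrable Fi.
- by move=> x; rewrite normrM ger0_norm ?odo_avg_ge0// ler_wpM2r ?odo_avg_le.
- by apply: integrable_EFinZ; exact: integrable_abse Fi.
Qed.

(** Induction on [n]: an integer shift [k] of the odometer becomes [k * D] under [L], then [k] after
    division by the degree, and passes through the floor. At [n = 0] the odometer vanishes and the
    claim is the hypothesis. *)
Lemma odo_superadditive (q : nat) (k : int) :
  (\forall x \ae P, k%:~R <= odo q x) ->
  forall n, \forall x \ae P, odo n x + k%:~R <= odo (n + q) x.
Proof.
move=> kq; elim=> [|n IH]; first by apply: filterS kq => x; rewrite add0r.
apply: filterS deg_floor_ae => x Dx.
rewrite addSn [leRHS]/= [leLHS]/= -intrD ler_int.
(* The integer [k] enters the floor, is written as [k * Dd / Dd], and then joins the argument of [L]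
   as a constant function. *)
rewrite -{1}(@intrKfloor R k) -floorDrz ?intr_int// le_floor//.
rewrite -[X in _ + X](mulfK (lt0r_neq0 (deg_floor_gt0 x))) -mulrDl.
rewrite ler_wpM2r ?invr_ge0 ?(ltW (deg_floor_gt0 x))// -addrA lerD2l Dx.
rewrite -kernel_op_cst// -kernel_opD//; last 2 first.
- exact: integrable_odo.
- exact: integrable_cstR.
apply: le_kernel_op => //; last exact: integrable_odo.
by apply: integrable_EFinD; [exact: integrable_odo|exact: integrable_cstR].
Qed.

End parallel_chip_firing.

(** * Summable series of numbers and of functions *)

Lemma sum_inv_sqr_le (R : realType) n :
  \sum_(0 <= j < n) (j.+1%:R ^+ 2)^-1 <= 2 :> R.
Proof.
(* The sharper bound makes the induction telescope; at [n = 0] the inverse of 0 is 0. *)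
suff : \sum_(0 <= j < n) (j.+1%:R ^+ 2)^-1 <= 2 - n%:R^-1 :> R.
  by move=> /le_trans; apply; rewrite gerBl invr_ge0.
elim: n => [|n IH]; first by rewrite big_geq// invr0 subr0.
rewrite big_nat_recr//=; case: n IH => [|n] IH.
  by rewrite big_geq// invr1 expr1n invr1; lra.
apply: le_trans (lerD IH (lexx _)) _.
have key (a : R) : 0 < a -> - a^-1 + ((a + 1) ^+ 2)^-1 <= - (a + 1)^-1.
  move=> a0; rewrite -subr_ge0.
  rewrite (_ : _ - _ = (a * (a + 1) ^+ 2)^-1); last first.
    by field; rewrite !gt_eqF ?addr_gt0.
  by rewrite invr_ge0 mulr_ge0 ?exprn_ge0 ?addr_ge0 ?ltW.
by rewrite -addrA lerD2l -(natr1 n.+1) key.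
Qed.

Lemma cvg_sqr0 (R : realType) (a : nat -> R) :
  (fun j => a j ^+ 2) @ \oo --> 0 -> a @ \oo --> 0.
Proof.
move=> /cvgr0Pnorm_lt a2; apply/cvgr0Pnorm_lt => e e0.
have := a2 (e ^+ 2) (exprn_gt0 2 e0); apply: filterS => j.
by rewrite normrX ltr_pXn2r ?nnegrE ?(ltW e0).
Qed.

Lemma nneseries_fin_cvg0 (R : realType) (a : nat -> R) : (forall j, 0 <= a j) ->
  (\sum_(0 <= j <oo) (a j)%:E < +oo)%E -> a @ \oo --> 0.
Proof.
move=> a0 Soo; apply: cvg_series_cvg_0.
have S0 : (0 <= \sum_(0 <= j <oo) (a j)%:E)%E.
  by apply: nneseries_ge0 => j _ _; rewrite lee_fin.
apply: nondecreasing_is_cvgn.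
  by apply/nondecreasing_seqP => n; rewrite /series /= big_nat_recr//= lerDl.
exists (fine (\sum_(0 <= j <oo) (a j)%:E)%E) => _ [n _ <-].
rewrite -lee_fin fineK; last by rewrite ge0_fin_numE.
rewrite /series /= -sumEFin; apply: nneseries_lim_ge => j _ _.
by rewrite lee_fin.
Qed.

Section ae_series.
Context d (T : measurableType d) (R : realType).
Variable mu : {measure set T -> \bar R}.

(** The series has finite integral by termwise integration of non-negative functions, and an
    integrable function is finite almost everywhere. *)
Lemma ae_nneseries_fin (f : nat -> T -> R) (K : R) :
  (forall j, mu.-integrable setT (EFin \o f j)) -> (forall j x, 0 <= f j x) ->
  (forall n, \sum_(0 <= j < n) \int[mu]_x f j x <= K) ->
  \forall x \ae mu, (\sum_(0 <= j <oo) (f j x)%:E < +oo)%E.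
Proof.
move=> fi f0 fK.
have mf j : measurable_fun setT (EFin \o f j) by exact: (measurable_int mu).
have S0 x : (0 <= \sum_(0 <= j <oo) (f j x)%:E)%E.
  by apply: nneseries_ge0 => j _ _; rewrite lee_fin.
have Si : mu.-integrable setT (fun x => \sum_(0 <= j <oo) (f j x)%:E)%E.
  apply/integrableP; split.
    apply: ge0_emeasurable_sum; first by move=> k x _ _; rewrite lee_fin.
    by move=> k _; exact: mf.
  under eq_integral do rewrite gee0_abs//.
  rewrite integral_nneseries//; last by move=> j x _; rewrite lee_fin.
  apply: (@le_lt_trans _ _ K%:E); last exact: ltry.
  apply: lime_le.
    apply: is_cvg_nneseries => j _ _.
    by apply: integral_ge0 => x _; rewrite lee_fin.
  apply: nearW => n.
  rewrite (eq_bigr (fun j => (\int[mu]_x f j x)%:E)); last first.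
    by move=> j _; rewrite -integral_EFin_Rintegral.
  by rewrite sumEFin lee_fin.
apply: filterS (integrable_ae measurableT Si) => x /(_ Logic.I).
by rewrite ge0_fin_numE.
Qed.

End ae_series.

(** * Connected kernels and propagation of vanishing differences *)

Section connected_kernel.
Context d (T : measurableType d) (R : realType).
Variables (P : probability T R) (W : T -> T -> R).
Hypothesis mW : measurable_fun setT (fun z : T * T => W z.1 z.2).
Hypothesis W01 : forall x y, 0 <= W x y <= 1.
Local Notation L := (kernel_op P W).
Local Notation D := (kernel_deg P W).
Local Notation integrable f := (P.-integrable setT (EFin \o f)).

(** Connectedness of a graphon: no cut with positive measure on both sides carries zero weight.
    Finite diameter enters the limit argument through this property and through the lower bound on
    degrees. *)
Definition connected_kernel := forall A : set T, measurable A -> (0 < P A)%E ->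
  (\forall x \ae P, ~ A x -> \forall y \ae P, A y -> W x y = 0) ->
  \forall x \ae P, A x.

Let q0 f x y : 0 <= W x y * (f x - f y) ^+ 2 :> R.
Proof. by rewrite mulr_ge0 ?sqr_ge0//; have /andP[] := W01 x y. Qed.

Let qM f M x y : (forall x, 0 <= f x <= M) ->
  W x y * (f x - f y) ^+ 2 <= M ^+ 2.
Proof.
move=> fM; have /andP[fx0 fxM] := fM x; have /andP[fy0 fyM] := fM y.
have /andP[w0 w1] := W01 x y.
apply: (@le_trans _ _ ((f x - f y) ^+ 2)); first by rewrite ler_piMl// sqr_ge0.
by rewrite -subr_ge0 subr_sqr mulr_ge0//; lra.
Qed.

Let mq (f : T -> R) : measurable_fun setT f -> measurable_fun setT
  (fun z : T * T => W z.1 z.2 * (f z.1 - f z.2) ^+ 2).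
Proof.
move=> mf; apply: measurable_funM => //; apply: measurable_funX.
by apply: measurable_funB; exact: (measurableT_comp mf).
Qed.

Let qi (f : T -> R) M x : measurable_fun setT f -> (forall x, 0 <= f x <= M) ->
  integrable (fun y => W x y * (f x - f y) ^+ 2).
Proof.
move=> mf fM; apply: (@integrable_bounded _ _ _ P (M ^+ 2)); last first.
  by move=> y; rewrite ger0_norm// qM.
exact: (measurable_fun_pair2
  (f := fun z : T * T => W z.1 z.2 * (f z.1 - f z.2) ^+ 2) x (mq mf)).
Qed.

Lemma integrable_kernel_gap (f : T -> R) M : measurable_fun setT f ->
  (forall x, 0 <= f x <= M) ->
  integrable (fun x => L (fun y => (f x - f y) ^+ 2) x).
Proof.
move=> mf fM; apply: (@integrable_bounded _ _ _ P (M ^+ 2)).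
  have := measurable_fun_fubini_tonelli_F (m2 := P)
    (fun z : T * T => (W z.1 z.2 * (f z.1 - f z.2) ^+ 2)%:E).
  move=> /(_ _ _)/(measurableT_comp (fine_measurable measurableT)); apply.
    by apply/measurable_EFinP; exact: mq.
  by move=> z; rewrite lee_fin.
move=> x; rewrite ger0_norm; last by apply: Rintegral_ge0 => y _.
rewrite -[leRHS](Rintegral_cst_prob P); apply: le_Rintegral => //.
- exact: qi fM.
- exact: integrable_cstR.
- by move=> y _; exact: qM.
Qed.

Variables (g : nat -> T -> R) (M K : R).
Hypothesis mg : forall j, measurable_fun setT (g j).
Hypothesis gM : forall j x, 0 <= g j x <= M.

(** Summability is used twice: first in [x] for the inner integrals, then in [y] for the integrands
    at a fixed good [x]. The summands tend to 0; dividing by [W x y > 0] and taking square roots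
    gives the claim. *)
Lemma ae_ae_small_energy :
  (forall j, \int[P]_x L (fun y => (g j x - g j y) ^+ 2) x
     <= K * (j.+1%:R ^+ 2)^-1) ->
  \forall x \ae P, \forall y \ae P, 0 < W x y ->
    (fun j => g j x - g j y) @ \oo --> 0.
Proof.
move=> EK.
have E0 j x : 0 <= L (fun y => (g j x - g j y) ^+ 2) x by apply: Rintegral_ge0 => y _.
(* The sign of [K] is read off from the bound at [j = 0], where the energy is non-negative. *)
have K0 : 0 <= K.
  have := le_trans (Rintegral_ge0 P (fun x _ => E0 0%N x)) (EK 0%N).
  by rewrite expr1n invr1 mulr1.
have EK2 n : \sum_(0 <= j < n) \int[P]_x L (fun y => (g j x - g j y) ^+ 2) x
    <= K * 2.
  apply: (@le_trans _ _ (\sum_(0 <= j < n) K * (j.+1%:R ^+ 2)^-1)).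
    by apply: ler_sum => j _.
  by rewrite -mulr_sumr ler_wpM2l// sum_inv_sqr_le.
apply: filterS (ae_nneseries_fin (fun j => integrable_kernel_gap (mg j) (gM j)) E0 EK2) => x Sx.
set K' := fine (\sum_(0 <= j <oo) (L (fun y => (g j x - g j y) ^+ 2) x)%:E)%E.
(* The inner integrals at this [x] are the terms of the convergent series [K'], so their partial
   sums are bounded as the second application requires. *)
have SK' n : \sum_(0 <= j < n) \int[P]_y (W x y * (g j x - g j y) ^+ 2) <= K'.
  rewrite -lee_fin /K' fineK; last first.
    by rewrite ge0_fin_numE//; apply: nneseries_ge0 => j _ _; rewrite lee_fin.
  rewrite -sumEFin; apply: nneseries_lim_ge => j _ _.
  by rewrite lee_fin; exact: (E0 j x).
have := ae_nneseries_fin (fun j => qi x (mg j) (gM j)) (fun j => q0 (g j) x) SK'.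
apply: filterS => y Sy Wxy.
have := nneseries_fin_cvg0 (fun j => q0 (g j) x y) Sy.
move=> /cvgM/(_ (cvg_cst (W x y)^-1)); rewrite mul0r.
under eq_cvg do rewrite /= mulrAC mulfV ?gt_eqF// mul1r.
exact: cvg_sqr0.
Qed.
Lemma ae_exists (Q : T -> Prop) : (\forall x \ae P, Q x) -> exists x, Q x.
Proof.
move=> QP; have P1 : (0 < P setT)%E by rewrite probability_setT lte01.
have PF := ae_properfilter_algebraOfSetsType P1.
exact: (@filter_ex _ _ PF).
Qed.

(** Expresses convergence to 0 through one limit superior, so that the set of points of convergence
    is the preimage of a point under a measurable function. *)
Lemma limn_esup_norm0P (a : nat -> R) :
  limn_esup (fun j => `|a j|%:E) = 0%E <-> a @ \oo --> 0.
Proof.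
split=> [a0|a0].
  apply/norm_cvg0P.
  have /fine_cvgP[] : (fun j => `|a j|%:E) @ \oo --> 0%:E => //.
  by apply: limn_esup_le_cvg => [|n]; rewrite ?a0// lee_fin.
have aE : (fun j => `|a j|%:E) @ \oo --> 0%E.
  by apply/cvg_EFin; [exact: nearW|exact/norm_cvg0P].
by rewrite is_cvg_limn_esupE; [exact/cvg_lim|apply/cvg_ex; exists 0%E].
Qed.

(** The set [A] of points whose gap to [x0] vanishes has positive measure, since [x0] has positive
    degree. Almost no point outside [A] has edges into it, because gaps add up along an edge;
    connectedness then makes [A] conull. *)
Lemma ae_cvg_of_connected (x0 : T) : connected_kernel -> 0 < D x0 ->
  (\forall y \ae P, 0 < W x0 y -> (fun j => g j x0 - g j y) @ \oo --> 0) ->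
  (\forall x \ae P, \forall y \ae P, 0 < W x y ->
    (fun j => g j x - g j y) @ \oo --> 0) ->
  \forall y \ae P, (fun j => g j x0 - g j y) @ \oo --> 0.
Proof.
move=> conn D0 hx0 hae.
pose A := [set y | (fun j => g j x0 - g j y) @ \oo --> 0].
have mA : measurable A.
  pose F y := limn_esup (fun j => `|g j x0 - g j y|%:E).
  have mF : measurable_fun setT F.
    apply: measurable_fun_limn_esup => j; apply/measurable_EFinP.
    by apply: measurableT_comp => //; exact: measurable_funB.
  rewrite (_ : A = F @^-1` [set 0%E]); last first.
    by apply/seteqP; split => y /limn_esup_norm0P.
  by rewrite -[X in measurable X]setTI; exact: mF.
apply: (conn A) => //.
  (* If [A] were null, almost every [y] would have [W x0 y = 0], and the degree of [x0] would
     vanish. *)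
  rewrite lt0e measure_ge0 andbT; apply/eqP => PA0.
  suff : D x0 = 0 by move=> D00; move: D0; rewrite D00 ltxx.
  rewrite /kernel_deg -[RHS](Rintegral_cst_prob P); apply: ae_eq_Rintegral => //.
    exact: measurable_kernel_section.
  have nA : \forall y \ae P, ~ A y.
    by exists A; split => // y /= /contrapT.
  apply: filterS2 hx0 nA => y hy nAy _.
  apply/eqP; rewrite eq_le; have /andP[-> _] := W01 x0 y; rewrite andbT leNgt.
  by apply/negP => /hy.
apply: filterS hae => x hx nAx; apply: filterS hx => y hy Ay.
apply/eqP; rewrite eq_le; have /andP[-> _] := W01 x y; rewrite andbT leNgt.
apply/negP => /hy xy; apply: nAx; rewrite /A /=.
rewrite (_ : (fun j => _) = (fun j => (g j x0 - g j y) - (g j x - g j y))).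
  by rewrite -[X in _ --> X](subr0 0); exact: cvgB.
by apply/funext => j; ring.
Qed.

End connected_kernel.

(** * Interpolation between consecutive squares *)

Lemma exists_square_le (n : nat) : exists j, (j ^ 2 <= n < j.+1 ^ 2)%N.
Proof.
elim: n => [|n [j /andP[jn nj]]]; first by exists 0%N.
have [nj'|nj'] := ltnP n.+1 (j.+1 ^ 2).
  by exists j; rewrite nj' andbT; exact: leq_trans jn _.
by exists j.+1; rewrite nj' /=; apply: leq_trans (_ : (j.+1 ^ 2).+1 <= _)%N => //;
  rewrite ltn_sqr.
Qed.

(* Between consecutive squares, whose ratio tends to 1, monotonicity controls
   the sequence. *)
Lemma cvg_average_of_squares (R : realType) (u r : nat -> R) (a : R) :
  0 <= a -> (forall n, 0 <= u n) -> {homo u : m n / (m <= n)%N >-> m <= n} ->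
  r @ \oo --> 0 ->
  (forall j, u (j.+1 ^ 2).+1 <= (j.+1 ^ 2)%:R * (a + r j)) ->
  (forall e : R, 0 < e -> exists c, forall n, n%:R * (a - e) - c <= u n) ->
  (fun n => u n / n%:R) @ \oo --> a.
Proof.
move=> a0 u0 undecr r0 uu ul.
(* Upper bound for [u n / n] when [n] runs from [(i+1)^2] up to, but excluding, [(i+2)^2]; the first
   factor is the ratio of these squares. *)
pose t i := (1 + harmonic i) ^+ 2 * (a + r i.+1).
have ta : t @ \oo --> a.
  have h1 : (fun i => 1 + harmonic i : R) @ \oo --> (1 + 0 : R).
    by apply: cvgD; [exact: cvg_cst|exact: cvg_harmonic].
  have ra : (fun i => a + r i.+1) @ \oo --> a + 0.
    by apply: cvgD; [exact: cvg_cst|rewrite (cvg_shiftS r)].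
  rewrite (_ : t = (fun i => (1 + harmonic i) * (1 + harmonic i) * (a + r i.+1))).
    have := cvgM (cvgM h1 h1) ra; rewrite !addr0 !mul1r.
    exact.
  by apply/funext => i; rewrite /t expr2.
apply/cvgrPdist_le => e e0.
have e20 : 0 < e / 2 by rewrite divr_gt0.
have [c hc] := ul _ e20.
have [J _ hJ] := (cvgrPdist_le _ _).1 ta _ e0.
near=> n.
have n0 : 0 < n%:R :> R by rewrite ltr0n; near: n; exact: nbhs_infty_gt.
have nJ : (J.+1 ^ 2 <= n)%N by near: n; exact: nbhs_infty_ge.
(* For such [n] the constant [c] is absorbed by the second half of [e]. *)
have cn : c / (e / 2) <= n%:R by near: n; exact: nbhs_infty_ger.
rewrite distrC ler_distl; apply/andP; split.
  rewrite ler_pdivlMr//; apply: le_trans (hc n).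
  move: cn; rewrite ler_pdivrMr// => cn; lra.
have [[|i] /andP[jn nj]] := exists_square_le n.
  by have := leq_ltn_trans nJ nj; rewrite ltn_sqr ltnS ltn0.
have Ji : (J <= i)%N.
  by have := leq_ltn_trans nJ nj; rewrite ltn_sqr !ltnS.
(* The sign, inherited from [u], is what allows replacing [(i+1)^2] by the larger [n] below. *)
have at0 : 0 <= a + r i.+1.
  have := le_trans (u0 _) (uu i.+1); rewrite pmulr_rge0// ltr0n expn_gt0 //.
have tE : (i.+2 ^ 2)%:R * (a + r i.+1) = (i.+1 ^ 2)%:R * t i.
  rewrite /t mulrA; congr (_ * _); rewrite !natrX -exprMn; congr (_ ^+ _).
  by rewrite mulrDr mulr1 mulfV ?pnatr_eq0// natr1.
have t0 : 0 <= t i by rewrite mulr_ge0// sqr_ge0.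
rewrite ler_pdivrMr//; apply: (@le_trans _ _ (u (i.+2 ^ 2).+1)).
  by apply: undecr; rewrite ltnW// ltnS ltnW.
apply: le_trans (uu _) _; rewrite tE.
apply: (@le_trans _ _ (n%:R * t i)); first by rewrite ler_wpM2r// ler_nat.
rewrite mulrC ler_wpM2r//.
by have := hJ i Ji; rewrite /= distrC ler_distl => /andP[].
Unshelve. all: by end_near. Qed.

(** * Existence of the activity for the odometer recursion *)

Section activity.
Context d (T : measurableType d) (R : realType).
Variables (P : probability T R) (W : T -> T -> R).
Hypothesis mW : measurable_fun setT (fun z : T * T => W z.1 z.2).
Hypothesis symW : forall x y, W x y = W y x.
Hypothesis W01 : forall x y, 0 <= W x y <= 1.
Variables (delta : R) (s : T -> R).
Hypothesis delta0 : 0 < delta.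
Hypothesis degW : \forall x \ae P, delta <= kernel_deg P W x.
Hypothesis s0 : forall x, 0 <= s x.
Hypothesis si : P.-integrable setT (EFin \o s).
Hypothesis connW : connected_kernel P W.

Local Notation L := (kernel_op P W).
Local Notation D := (kernel_deg P W).
Local Notation integrable f := (P.-integrable setT (EFin \o f)).
Local Notation u := (odo P W delta s).
Local Notation h := (odo_avg P W delta s).
Local Notation Dd := (deg_floor P W delta).

Let S := \int[P]_x s x.
Let C := S / delta / delta.

Let N (j : nat) := (j.+1 ^ 2)%N.
Let g j x := (N j)%:R^-1 * h (N j) x.

Let N0 j : 0 < (N j)%:R :> R. Proof. by rewrite ltr0n expn_gt0. Qed.

Let hE j x : h (N j) x = (N j)%:R * g j x.
Proof. by rewrite /g mulVKf// gt_eqF. Qed.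

Let hi := integrable_odo_avg mW symW W01 delta0 degW s0 si.

Let mg j : measurable_fun setT (g j).
Proof. by apply: measurable_funM => //; exact: measurable_integrable (hi _). Qed.

Let g0C j x : 0 <= g j x <= C.
Proof.
rewrite mulr_ge0 ?invr_ge0 ?(ltW (N0 j))//=; last exact: odo_avg_ge0.
by rewrite /g mulrC ler_pdivrMr// mulrC; exact: odo_avg_le.
Qed.

Let gi j : integrable (g j).
Proof. by apply: integrable_EFinZ; exact: hi. Qed.

(** The energy is quadratic, so scaling by the inverse of [N j] turns its linear bound into a
    multiple of [1 / N j], which is summable. *)
Let gap_ae : \forall x \ae P, \forall y \ae P, 0 < W x y ->
  (fun j => g j x - g j y) @ \oo --> 0.
Proof.
apply: (@ae_ae_small_energy _ _ _ _ _ mW W01 _ C (4 * S * C / delta)) => // j.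
have E x : L (fun y => (g j x - g j y) ^+ 2) x =
    (N j)%:R ^- 2 * L (fun y => (h (N j) x - h (N j) y) ^+ 2) x.
  rewrite -kernel_opZ//.
    by apply: eq_Rintegral => y _; congr (_ * _); rewrite -exprVn -exprMn mulrBr.
  apply: (@integrable_bounded _ _ _ P (((N j)%:R * C) ^+ 2)).
    apply: measurable_funX; apply: measurable_funB => //.
    exact: measurable_integrable (hi _).
  move=> y; rewrite ger0_norm ?sqr_ge0// -subr_ge0 subr_sqr.
  have key (c p q : R) : 0 <= p <= c -> 0 <= q <= c ->
      0 <= c - (p - q) /\ 0 <= c + (p - q) by lra.
  have [? ?] := key _ _ _ (g0C j x) (g0C j y).
  rewrite !hE -!mulrBr -mulrDr.
  by apply: mulr_ge0; apply: mulr_ge0; rewrite ?(ltW (N0 j))// mulrBr.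
under eq_Rintegral do rewrite E.
have EN := odo_avg_energy mW symW W01 delta0 degW s0 si (N j).
have Ei : integrable (fun x => L (fun y => (h (N j) x - h (N j) y) ^+ 2) x).
  have := @integrable_kernel_gap _ _ _ _ _ mW W01 (h (N j)) ((N j)%:R * C).
  apply; first exact: measurable_integrable (hi _).
  by move=> x; rewrite odo_avg_ge0//= odo_avg_le.
rewrite RintegralZl//.
apply: le_trans (ler_wpM2l _ EN) _; first by rewrite invr_ge0 sqr_ge0.
rewrite -[in leRHS]natrX -/(N j) -/S -/C mulrA [leLHS]mulrC ler_wpM2l//.
  have C0 : 0 <= C by have /andP[p q] := g0C 0 point; exact: le_trans p q.
  have S0 : 0 <= S by exact: Rintegral_ge0.
  by rewrite !mulr_ge0// invr_ge0 ltW.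
by rewrite expr2 invfM -mulrA mulVf ?mulr1// gt_eqF.
Qed.

(** The common sequence is [g] evaluated at one base point [x0] with positive degree and vanishing
    gaps to almost all its neighbours. *)
Let exists_center : exists gam : nat -> R, (forall j, 0 <= gam j <= C) /\
  \forall y \ae P, (fun j => gam j - g j y) @ \oo --> 0.
Proof.
have Dpos : \forall x \ae P, 0 < D x.
  by apply: filterS degW => x; exact: lt_le_trans.
have [x0 [Dx0 hx0]] : exists x0, 0 < D x0 /\
    \forall y \ae P, 0 < W x0 y -> (fun j => g j x0 - g j y) @ \oo --> 0.
  by apply: (@ae_exists _ _ _ P); apply: filterS2 Dpos gap_ae.
exists (g ^~ x0); split => //.
exact: (ae_cvg_of_connected mW W01 mg connW Dx0 hx0 gap_ae).
Qed.

Let err (gam : nat -> R) j := \int[P]_y `|gam j - g j y|.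

(** Dominated convergence with the constant [C]: both sequences take values between 0 and [C]. *)
Let err_cvg gam : (forall j, 0 <= gam j <= C) ->
  (\forall y \ae P, (fun j => gam j - g j y) @ \oo --> 0) ->
  err gam @ \oo --> 0.
Proof.
move=> gamC gamg.
have mF j : measurable_fun setT (fun y => (gam j - g j y)%:E).
  by apply/measurable_EFinP; exact: measurable_funB.
have := @dominated_convergence _ _ _ P setT measurableT
  (fun j y => (gam j - g j y)%:E) (cst 0%E) (cst C%:E) mF.
case=> //.
- apply: filterS gamg => y gy _; apply/cvg_EFin; first exact: nearW.
  exact: gy.
- exact: integrable_cstR.
- apply: aeW => y j _ /=; rewrite lee_fin ler_norml.
  have /andP[? ?] := gamC j; have /andP[? ?] := g0C j y.
  by apply/andP; split; lra.
move=> _ + _.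
have -> : [sequence \int[P]_x `|(gam n - g n x)%:E - cst 0 x|]_n%E =
    (fun j => (err gam j)%:E).
  apply/funext => j; rewrite /err -integral_EFin_Rintegral.
    by apply: eq_integral => y _; rewrite /= subr0.
  have : integrable (fun y => gam j - g j y).
    by apply: integrable_EFinB => //; exact: integrable_cstR.
  exact: integrable_abse.
by move=> /fine_cvgP[].
Qed.

(** Each of the two further steps loses at most 1 to the floor, whence the [2]. Replacing [g j] by
    the constant [gam j] under [L] costs at most the L^1 distance [err gam j], and division by the
    degree turns this into [err gam j / delta]. *)
Let odo_lower gam j : \forall x \ae P,
  (N j)%:R * (gam j - err gam j / delta) - 2 <= u (N j).+2 x.
Proof.
apply: filterS (deg_floor_ae degW) => x Dx.
have Dd0 : 0 < Dd x := deg_floor_gt0 _ _ delta0 x.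
have h1 y : h (N j) y - 1 <= u (N j).+1 y.
  apply/ltW/(le_lt_trans _ (odoS_gt _ _ _ _ _ _)).
  rewrite lerD2r ler_wpM2r ?invr_ge0 ?lerDr//.
  exact/ltW/deg_floor_gt0.
have ui := integrable_odo mW W01 delta0 s0 si (N j).+1.
have i1 := integrable_cstR P 1.
have Lu : L (h (N j)) x - D x <= L (u (N j).+1) x.
  rewrite -(mul1r (D x)) -kernel_op_cst// -kernel_opB//.
  by apply: le_kernel_op => //; [exact: integrable_EFinB|exact: aeW].
have Lg : gam j * D x - err gam j <= L (g j) x.
  rewrite lerBlDr -lerBlDl -kernel_op_cst// -kernel_opB//; last exact: integrable_cstR.
  apply: le_trans (ler_norm _) _; apply: kernel_op_norm_le => //.
  by apply: integrable_EFinB => //; exact: integrable_cstR.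
have e0 : 0 <= err gam j by exact: Rintegral_ge0.
apply/ltW/(le_lt_trans _ (odoS_gt _ _ _ _ _ _)).
rewrite (_ : 2 = 1 + 1 :> R)// opprD addrA lerD2r.
rewrite ler_pdivlMr//.
have LhE : L (h (N j)) x = (N j)%:R * L (g j) x.
  by rewrite -kernel_opZ//; apply: eq_Rintegral => y _; rewrite hE.
have De : err gam j <= err gam j / delta * Dd x.
  rewrite mulrAC -mulrA ler_peMr// ler_pdivlMr// mul1r; exact: deg_floor_ge.
have := ler_wpM2l (ltW (N0 j)) Lg; have := ler_wpM2l (ltW (N0 j)) De.
have := s0 x; move: Lu; rewrite LhE -Dx -/S; nra.
Qed.

Let rates := [set r : R | exists q k : nat, [/\ (0 < q)%N,
  \forall x \ae P, k%:R <= u q x & r = k%:R / q%:R]].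

Let a := sup rates.

(** A constant below [u q] almost everywhere is below its mean, which is at most
    [q * (S / delta)]. *)
Let has_sup_rates : has_sup rates.
Proof.
split.
  exists 0, 1%N, 0%N; split => //; last by rewrite mul0r.
  by apply: aeW => x; exact: odo_ge0.
exists (S / delta) => _ [q [k [q0 kq ->]]].
rewrite ler_pdivrMr ?ltr0n// mulrC.
apply: le_trans (Rintegral_odo_le mW symW W01 delta0 degW s0 si q).
rewrite -[leLHS](Rintegral_cst_prob P); apply: ae_le_Rintegral => //.
  exact: integrable_cstR.
exact: integrable_odo.
Qed.

Let rate_le q k : (0 < q)%N -> (\forall x \ae P, k%:R <= u q x) ->
  k%:R <= a * q%:R.
Proof.
move=> q0 kq; rewrite -ler_pdivrMr ?ltr0n//.
by apply: ub_le_sup; [case: has_sup_rates|exists q, k].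
Qed.

Let a0 : 0 <= a.
Proof.
have := @rate_le 1 0 isT; rewrite mulr1; apply.
by apply: aeW => x; exact: odo_ge0.
Qed.

(** The integer part of the lower bound in [odo_lower] is an admissible [k] for [q = N j + 2];
    rounding down costs 1 more, hence [3]. A negative bound is trivial because [a >= 0]. *)
Let gam_le gam j : (N j)%:R * (gam j - err gam j / delta) - 3 <= a * (N j).+2%:R.
Proof.
set B := (N j)%:R * (gam j - err gam j / delta) - 2.
have [B0|B0] := leP 0 B; last first.
  have := mulr_ge0 a0 (ler0n R (N j).+2); rewrite /B in B0; lra.
have := truncn_itv B0 => /andP[kB Bk].
have : (Num.truncn B)%:R <= a * (N j).+2%:R.
  apply: rate_le => //; apply: filterS (odo_lower gam j) => x; exact: le_trans.
by move: Bk; rewrite -natr1 /B; lra.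
Qed.

(** Fekete's argument: choose [k / q > a - e], iterate superadditivity over the [n %/ q] full
    blocks, and use monotonicity for the remainder. The incomplete block costs at most [k], which
    serves as [c]. *)
Let odo_ge_rate (e : R) : 0 < e ->
  exists c, \forall x \ae P, forall n, n%:R * (a - e) - c <= u n x.
Proof.
move=> e0.
have [_ [q [k [q0 kq ->]]] ake] := sup_adherent e0 has_sup_rates.
exists k%:R; apply: ae_foralln => n.
have Hi i : \forall x \ae P, (i * k)%:R <= u (i * q) x.
  elim: i => [|i IH]; first by apply: aeW => x; exact: odo_ge0.
  have kq' : \forall x \ae P, (Posz k)%:~R <= u q x by [].
  have := odo_superadditive mW W01 delta0 degW s0 si kq' (i * q).
  rewrite !mulSnr natrD; apply: filterS2 IH => x IH; apply: le_trans.
  by rewrite lerD2r.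
apply: filterS (Hi (n %/ q)%N) => x Hx.
apply: le_trans (odo_le mW W01 delta0 s0 si x (leq_trunc_div n q)).
apply: le_trans Hx; apply: (@le_trans _ _ (n%:R * (k%:R / q%:R) - k%:R)).
  by rewrite lerD2r ler_wpM2l// ltW.
rewrite lerBlDr -natrD -mulSnr natrM mulrCA [leLHS]mulrC.
rewrite ler_wpM2r// ler_pdivrMr ?ltr0n// -natrM ler_nat ltnW//.
by rewrite mulSn addnC {1}(divn_eq n q) ltn_add2l ltn_mod.
Qed.

Let inv_N_cvg : (fun j => (N j)%:R^-1 : R) @ \oo --> 0.
Proof.
rewrite (_ : (fun j => _) = (fun j => harmonic j * harmonic j)).
  by rewrite -[X in _ --> X](mulr0 0); apply: cvgM; exact: cvg_harmonic.
by apply/funext => j; rewrite /N natrX expr2 invfM.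
Qed.

Theorem odo_activity : exists a : R,
  \forall x \ae P, (fun n => u n x / n%:R) @ \oo --> a.
Proof.
have [gam [gamC gamg]] := exists_center.
have errc := err_cvg gamC gamg.
exists a.
(* Countably many tolerances [1 / (m+1)] leave a single exceptional null set. *)
have lower : \forall x \ae P, forall m : nat,
    exists c, forall n, n%:R * (a - m.+1%:R^-1) - c <= u n x.
  apply: ae_foralln => m.
  have [|c hc] := @odo_ge_rate m.+1%:R^-1; first by rewrite invr_gt0.
  by apply: filterS hc => x hx; exists c.
apply: filterS2 lower gamg => x low gx.
(* The error collects [s x / delta] from the initial chips, [3 + 2 * a] from [gam_le] at index
   [N j + 2], the gap between [gam j] and [g j x], and the L^1 error. *)
pose r j := (s x / delta + 3 + 2 * a) * (N j)%:R^-1 - (gam j - g j x)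
  + err gam j * delta^-1.
apply: (@cvg_average_of_squares _ _ r) => //.
- by move=> n; exact: odo_ge0.
- by move=> m n; exact: odo_le.
- rewrite -[X in _ --> X]addr0; apply: cvgD.
    rewrite -[X in _ --> X]subr0; apply: cvgB => //.
    rewrite -[X in _ --> X](mulr0 (s x / delta + 3 + 2 * a)).
    by apply: cvgM => //; exact: cvg_cst.
  by rewrite -[X in _ --> X](mul0r delta^-1); apply: cvgM => //; exact: cvg_cst.
- move=> j; apply: le_trans (odoS_le _ _ _ _ _ _) _; rewrite -/(N j) mulrDl.
  have sx : s x / Dd x <= s x / delta by exact: div_deg_floor_le.
  have hx : L (u (N j)) x / Dd x = (N j)%:R * g j x := hE j x.
  rewrite hx; have := gam_le gam j.
  have -> : (N j)%:R * (a + r j) = (N j)%:R * a + (s x / delta + 3 + 2 * a)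
      - (N j)%:R * (gam j - g j x) + (N j)%:R * (err gam j / delta).
    by rewrite /r; field; rewrite !gt_eqF.
  rewrite -natr1 -natr1.
  by lra.
- move=> e e0.
  have [m em] : exists m : nat, m.+1%:R^-1 < e.
    have [m _ /(_ _ (leqnn m))] := (cvgr0Pnorm_lt _).1 cvg_harmonic e e0.
    by rewrite /= ger0_norm// => ?; exists m.
  have [c hc] := low m; exists c => n.
  by apply: le_trans (hc n); rewrite lerD2r ler_wpM2l// lerD2l lerN2 ltW.
Qed.

End activity.

(** * Removing null sets from completed measurability *)

Section completion.
Context d (T : measurableType d) (R : realType).
Variable mu : {measure set T -> \bar R}.

(** The sets that become measurable after deleting a measurable null set form a sigma-algebra
    containing the generators, each a measurable set together with a negligible one. *)
Lemma completed_set_mod_null (B : set T) : <<s completed_algebra_gen mu >> B ->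
  exists N, [/\ measurable N, mu N = 0%E & measurable (B `\` N)].
Proof.
pose G := [set B | exists N, [/\ measurable N, mu N = 0%E & measurable (B `\` N)]].
apply: (@smallest_sub _ _ _ G); last first.
  move=> _ [A mA [M [N [mN N0 MN]] <-]]; exists N; split => //.
  rewrite setDUl (_ : M `\` N = set0) ?setU0; first exact: measurableD.
  by apply/seteqP; split => // x [/MN].
split.
- by exists set0; split; rewrite ?measure0// set0D.
- move=> A [N [mN N0 mAN]]; exists N; split => //.
  rewrite (_ : _ `\` _ = ~` (A `\` N) `\` N).
    by apply: measurableD => //; exact: measurableC.
  apply/seteqP; split => x /= [].
    by move=> [_ nA] nN; split => // -[].
  by move=> h nN; split => //; split => // Ax; apply: h.
- move=> A /choice[N hN]; exists (\bigcup_k N k).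
  have mN k : measurable (N k) by have [] := hN k.
  have mUN : measurable (\bigcup_k N k) by exact: bigcupT_measurable.
  split => //.
    apply: measure_negligible => //; apply: negligible_bigcup => k.
    by exists (N k); have [? ? ?] := hN k; split.
  rewrite (_ : _ `\` _ = (\bigcup_k (A k `\` N k)) `\` (\bigcup_k N k)).
    apply: measurableD => //; apply: bigcupT_measurable => k.
    by have [] := hN k.
  apply/seteqP; split => x /= [[k _]].
    move=> Akx nN; split => //; exists k => //; split => // Nk.
    by apply: nN; exists k.
  by move=> [Akx _] nN; split => //; exists k.
Qed.

(** Only rational superlevel sets are corrected, so the exceptional set is a countable union of null
    sets; a real level [x] is then the union of the rational levels [q >= x]. *)
Lemma completed_fun_mod_null (D : set T) (f : T -> R) : measurable D ->
  measurable_fun (D : set (g_sigma_algebraType (completed_algebra_gen mu))) f ->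
  exists N, [/\ measurable N, mu N = 0%E & measurable_fun (D `\` N) f].
Proof.
move=> mD mf.
have mD' : <<s completed_algebra_gen mu >> D.
  apply: sub_gen_smallest; exists D => //; exists set0; last by rewrite setU0.
  exact: negligible_set0.
have H (q : rat) : exists N, [/\ measurable N, mu N = 0%E &
    measurable ((D `&` f @^-1` `]ratr q, +oo[) `\` N)].
  by apply: completed_set_mod_null; exact: mf.
have /choice[N hN] := H.
have mN q : measurable (N q) by have [] := hN q.
have mUN : measurable (\bigcup_q N q) by exact: bigcupT_measurable_rat.
exists (\bigcup_q N q); split => //.
  apply: measure_negligible => //.
  apply: (@negligibleS _ _ _ _ (\bigcup_k N (odflt 0 (unpickle k)))).
    by move=> x [q _ Nq]; exists (pickle q) => //; rewrite pickleK.
  apply: negligible_bigcup => k; set q := odflt _ _.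
  by exists (N q); have [? ? ?] := hN q; split.
apply: (measurability (@RGenOInfty.G R) (RGenOInfty.measurableE R)).
move=> _ [_ [x ->] <-].
rewrite (_ : _ `&` _ = \bigcup_(q : rat)
    (if x <= ratr q then ((D `&` f @^-1` `]ratr q, +oo[) `\` N q)
                         `\` \bigcup_q N q else set0)).
  apply: bigcupT_measurable_rat => q; case: ifP => // _.
  by apply: measurableD => //; have [] := hN q.
apply/seteqP; split => y /=.
  rewrite in_itv/= andbT => -[[Dy nNy] xy].
  have [q /andP[xq qy]] := rat_in_itvoo xy.
  exists q => //; rewrite (ltW xq) /=; split => //; split; last first.
    by move=> Nq; apply: nNy; exists q.
  by split => //; rewrite in_itv/= andbT.
move=> [q _]; case: ifP => // xq [[[Dy qy] _] nN]; split => //.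
by move: qy; rewrite /= !in_itv/= !andbT; exact: le_lt_trans.
Qed.

End completion.

(** * Sections of null sets, and integration modulo null sets *)

Section null_sections.
Context d1 d2 (T1 : measurableType d1) (T2 : measurableType d2) (R : realType).
Variables (m1 : {sigma_finite_measure set T1 -> \bar R})
  (m2 : {sigma_finite_measure set T2 -> \bar R}).

Lemma ae_null_xsection (N : set (T1 * T2)) : measurable N ->
  (m1 \x m2)%E N = 0%E ->
  \forall x \ae m1, \forall y \ae m2, ~ N (x, y).
Proof.
move=> mN N0.
have mF : measurable_fun setT (m2 \o xsection N) by exact: measurable_fun_xsection.
have : (\int[m1]_x `|(m2 \o xsection N) x| = 0)%E.
  by rewrite -[RHS]N0; apply: eq_integral => x _; rewrite gee0_abs.
move=> /(ae_eq_integral_abs _ measurableT mF).1; apply: filterS => x /(_ Logic.I).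
move=> /= Nx0; exists (xsection N x); split => //.
  exact: measurable_xsection.
by move=> y /= /contrapT; rewrite /xsection/= inE.
Qed.

(** The product measure integrates the measures of [x]-sections, so this direction goes through
    Tonelli for the indicator of [N]. *)
Lemma ae_null_ysection (N : set (T1 * T2)) : measurable N ->
  (m1 \x m2)%E N = 0%E ->
  \forall y \ae m2, \forall x \ae m1, ~ N (x, y).
Proof.
move=> mN N0.
have mF : measurable_fun setT (m1 \o ysection N) by exact: measurable_fun_ysection.
have : (\int[m2]_y `|(m1 \o ysection N) y| = 0)%E.
  rewrite -[RHS]N0 [RHS](_ : _ = \int[m1]_x \int[m2]_y (\1_N (x, y))%:E)%E.
    rewrite (fubini_tonelli (fun z => (\1_N z)%:E)); last 2 first.
    - by apply/measurable_EFinP; exact: measurable_indic.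
    - by move=> z; rewrite lee_fin.
    apply: eq_integral => y _; rewrite gee0_abs// -indic_fubini_tonelli_GE//.
  by apply: eq_integral => x _; rewrite -indic_fubini_tonelli_FE.
move=> /(ae_eq_integral_abs _ measurableT mF).1; apply: filterS => y /(_ Logic.I).
move=> /= Ny0; exists (ysection N y); split => //.
  exact: measurable_ysection.
by move=> x /= /contrapT; rewrite /ysection/= inE.
Qed.

End null_sections.

(** The integral of a non-negative function is the supremum over the simple functions below it, and
    enlarging the function enlarges that family. *)
Lemma ge0_le_integral_nonmeasurable d (T : measurableType d) (R : realType)
    (mu : {measure set T -> \bar R}) (f g : T -> \bar R) :
  (forall x, 0 <= f x)%E -> (forall x, f x <= g x)%E ->
  (\int[mu]_x f x <= \int[mu]_x g x)%E.
Proof.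
move=> f0 fg; have g0 x : (0 <= g x)%E := le_trans (f0 x) (fg x).
rewrite !ge0_integralTE//; apply: le_ereal_sup => _ [h /= hf <-].
by exists h => // x; exact: le_trans (fg x).
Qed.

Lemma complete_measurable_fun d (T : measurableType d) (R : realType)
    (mu : {measure set T -> \bar R}) (D : set T) (f g : T -> R) :
  measure_is_complete mu -> measurable D ->
  (\forall x \ae mu, D x -> f x = g x) ->
  measurable_fun D g -> measurable_fun D f.
Proof.
move=> cmu mD [N [mN N0 hN]] mg _ Y mY.
rewrite (_ : D `&` f @^-1` Y =
    ((D `&` g @^-1` Y) `\` N) `|` ((D `&` f @^-1` Y) `&` N)).
  apply: measurableU; first by apply: measurableD => //; exact: mg.
  by apply: cmu; exists N; split => // x [].
have fgN x : D x -> ~ N x -> f x = g x.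
  move=> Dx nN; apply: contrapT => h; apply: nN; apply: hN => /= k.
  by apply: h; exact: k.
apply/seteqP; split => x /=.
  move=> [Dx fx]; have [Nx|nN] := pselect (N x); first by right.
  by left; rewrite -fgN.
by move=> [[[Dx gx] nN]|[]//]; split => //; rewrite fgN.
Qed.

Lemma complete_ae_eq_Rintegral d (T : measurableType d) (R : realType)
    (mu : {measure set T -> \bar R}) (D : set T) (f g : T -> R) :
  measure_is_complete mu -> measurable D -> measurable_fun D g ->
  (\forall x \ae mu, D x -> f x = g x) ->
  \int[mu]_(x in D) f x = \int[mu]_(x in D) g x.
Proof.
move=> cmu mD mg fg; apply: ae_eq_Rintegral => //.
exact: complete_measurable_fun fg mg.
Qed.

(** * Lebesgue measure on the unit interval as a probability *)

Section unit_interval.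
Variable R : realType.

Local Notation lambda := (@completed_lebesgue_measure R).
Local Notation T := (lebesgue_line R).
Local Notation I := (@I01 R).

Lemma borel_lebesgue (A : set R) :
  measurable (A : set (measurableTypeR R)) -> measurable (A : set T).
Proof. exact: sub_caratheodory. Qed.

Lemma measurable_I01 : measurable (I : set T).
Proof. by apply: borel_lebesgue; exact: measurable_itv. Qed.

Lemma lambda_I01 : lambda I = 1%E.
Proof.
rewrite -[LHS]/(lebesgue_measure (I : set R)) /I01 lebesgue_measure_itv/=.
by rewrite lte_fin ltr01 oppr0 adde0.
Qed.

(** Carried by the whole line instead of a subtype, so that the general results over [setT] apply
    and functions need no change of domain. *)
Definition unit_lebesgue : set T -> \bar R := mrestr lambda measurable_I01.

HB.instance Definition _ := Measure.on unit_lebesgue.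

Let unit_lebesgueT : unit_lebesgue setT = 1%E.
Proof. by rewrite /unit_lebesgue /mrestr setTI lambda_I01. Qed.

HB.instance Definition _ :=
  Measure_isProbability.Build _ _ _ unit_lebesgue unit_lebesgueT.

Local Notation P := (unit_lebesgue : probability T R).

#[global] Instance ae_lambda_filter : Filter (nbhs (almost_everywhere lambda)).
Proof. exact: ae_filter_ringOfSetsType. Qed.

#[global] Instance ae_unit_filter : Filter (nbhs (almost_everywhere unit_lebesgue)).
Proof. exact: ae_filter_ringOfSetsType. Qed.

Lemma ae_unitP (Q : R -> Prop) :
  (\forall x \ae P, Q x) <-> (\forall x \ae lambda, I x -> Q x).
Proof.
split=> -[B [mB B0 QB]].
  exists (B `&` I); split => //; first exact: measurableI measurable_I01.
  move=> x /= /not_implyP[Ix nQ]; split => //; exact: QB.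
exists (B `|` ~` I); split.
- by apply: measurableU => //; apply: measurableC; exact: measurable_I01.
- rewrite -[LHS]/(lambda ((B `|` ~` I) `&` I)) setIUl setICl setU0.
  apply: (@subset_measure0 _ _ _ lambda _ B) => //.
  exact: measurableI measurable_I01.
- move=> x /= nQ; have [Ix|nI] := pselect (I x); last by right.
  by left; apply: QB => /= /(_ Ix).
Qed.

Lemma integral_unit (f : T -> \bar R) : (forall x, ~ I x -> f x = 0%E) ->
  (\int[P]_x f x = \int[lambda]_(x in I) f x)%E.
Proof.
move=> f0; have fI : f = f \_ I.
  apply/funext => x; rewrite patchE; case: ifPn => // /negP xI.
  by rewrite f0// => Ix; apply: xI; rewrite inE.
rewrite {1}fI -integral_mkcond; apply: eq_measure_integral => A mA AI.
by rewrite -[LHS]/(lambda (A `&` I)) setIidl.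
Qed.

Lemma Rintegral_unit (f : T -> R) : (forall x, ~ I x -> f x = 0) ->
  \int[P]_x f x = \int[lambda]_(x in I) f x.
Proof.
by move=> f0; rewrite /Rintegral integral_unit// => x nI; rewrite f0.
Qed.

(** [lambda] is given by an outer measure, hence monotone on arbitrary sets. *)
Lemma le_lambda (A B : set R) : A `<=` B -> (lambda A <= lambda B)%E.
Proof. exact: (le_outer_measure ((wlength idfun)^*)%mu). Qed.

(** [X] may be a union of iterates of [Gamma], whose measure is only an outer one. It is covered by
    [E] and a null set, so [E] has measure at least 1. *)
Lemma ae_unit_of_full (X E : set R) : measurable (E : set T) -> X `<=` I ->
  lambda X = 1%E -> (\forall x \ae P, X x -> E x) -> \forall x \ae P, E x.
Proof.
move=> mE XI X1 /ae_unitP[N [mN N0 XEN]].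
have PE : P E = 1%E.
  apply/eqP; rewrite eq_le probability_le1//=.
  have <- : lambda ((E `&` I) `|` N) = P E.
    rewrite measureU0//; exact: measurableI measurable_I01.
  rewrite -X1; apply: le_lambda => x Xx.
  have [Ex|nE] := pselect (E x); first by left; split => //; exact: XI.
  by right; apply: XEN => /= h; apply: nE; exact: h (XI _ Xx) Xx.
exists (~` E); split => //; first exact: measurableC.
by rewrite [LHS]probability_setC// PE subee.
Qed.

End unit_interval.

(** * Replacing a graphon by a Borel representative *)

Section borel_graphon.
Variable R : realType.

Local Notation lambda := (@completed_lebesgue_measure R).
Local Notation leb := (@lebesgue_measure R).
Local Notation B := (measurableTypeR R).
Local Notation T := (lebesgue_line R).
Local Notation I := (@I01 R).

Lemma ae_lebesgue_completed (Q : R -> Prop) :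
  (\forall x \ae leb, Q x) -> \forall x \ae lambda, Q x.
Proof.
by move=> [A [mA A0 QA]]; exists A; split => //; exact: borel_lebesgue.
Qed.

Lemma measurable_fun_plane (f : R * R -> R) :
  measurable_fun setT (f : B * B -> R) -> measurable_fun setT (f : T * T -> R).
Proof.
move=> mf.
have mi : measurable_fun setT (id : T -> B).
  by move=> _ Y mY; rewrite setTI; exact: borel_lebesgue.
have mid : measurable_fun setT (fun z : T * T => (z.1, z.2) : B * B).
  apply: measurable_fun_pair.
    exact: (measurableT_comp (g := fst) mi measurable_fst).
  exact: (measurableT_comp (g := snd) mi measurable_snd).
rewrite (_ : f = f \o (fun z : T * T => (z.1, z.2) : B * B)).
  exact: (measurableT_comp mf mid).
by apply/funext => -[].
Qed.

(** The Fubini arguments run on the product sigma-algebra, while [W] is measurable for the completed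
    plane. Setting [W] to 0 on a null set and outside the square repairs this; almost all sections
    of the null set are null, so almost every row changes only on a null set. *)
Lemma graphon_borel (W : R -> R -> R) : graphon W -> exists W' : T -> T -> R,
  [/\ measurable_fun setT (fun z : T * T => W' z.1 z.2),
      forall x y, W' x y = W' y x,
      forall x y, 0 <= W' x y <= 1,
      forall x y, ~ I y -> W' x y = 0 &
      \forall x \ae lambda, I x -> \forall y \ae lambda, I y -> W x y = W' x y].
Proof.
move=> [mW symW W01].
have mI : measurable (I : set B) by exact: measurable_itv.
have mII : measurable (I `*` I : set (B * B)) by exact: measurableX.
have [N [mN N0 mWN]] := completed_fun_mod_null mII mW.
(* Adding the mirror image of [N] keeps the corrected kernel symmetric. *)
pose N' : set (B * B) := N `|` (fun z => (z.2, z.1)) @^-1` N.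
have mN' : measurable N'.
  apply: measurableU => //; rewrite -[X in measurable X]setTI.
  have mswap : measurable_fun setT (fun z : B * B => (z.2, z.1)).
    by apply: measurable_fun_pair.
  exact: mswap.
pose D := (I `*` I) `\` N'.
have mD : measurable D by exact: measurableD.
pose w := (fun z : B * B => W z.1 z.2) \_ D.
have mw : measurable_fun setT w.
  apply: (measurable_restrictT (fun z : B * B => W z.1 z.2) mD).1.
  apply: measurable_funS mWN; first exact: measurableD.
  by move=> z [IIz nN']; split => // Nz; apply: nN'; left.
have symD x y : D (x, y) -> D (y, x).
  move=> [[/= Ix Iy] nN']; split => // -[Nz|Nz]; apply: nN'.
    by right.
  by left.
exists (fun x y => w (x, y)); split.
- rewrite (_ : (fun z => _) = w); first exact: measurable_fun_plane.
  by apply/funext => -[].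
- move=> x y; rewrite /w !patchE; case: ifPn => [|/negP].
    rewrite inE => Dxy; rewrite ifT ?inE; last exact: symD.
    by case: Dxy => -[/= Ix Iy] _; exact: symW.
  rewrite inE => nD; case: ifPn => //; rewrite inE => /symD //.
- move=> x y; rewrite /w patchE; case: ifPn; last by rewrite lexx ler01.
  by rewrite inE => -[[/= Ix Iy] _]; exact: W01.
- move=> x y nI; rewrite /w patchE; case: ifPn => //.
  by rewrite inE => -[[/= _ Iy]].
- have := ae_null_ysection mN N0; have := ae_null_xsection mN N0.
  move=> /ae_lebesgue_completed h1 /ae_lebesgue_completed h2.
  apply: filterS2 h1 h2 => x /ae_lebesgue_completed h1 /ae_lebesgue_completed h2 Ix.
  apply: filterS2 h1 h2 => y h1 h2 Iy.
  by rewrite /w patchE ifT// inE; split => // -[].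
Qed.

End borel_graphon.

(** * Transfer from the odometer recursion to the graphon *)

Section graphon_activity.
Variable R : realType.

Local Notation lambda := (@completed_lebesgue_measure R).
Local Notation T := (lebesgue_line R).
Local Notation I := (@I01 R).
Local Notation P := (@unit_lebesgue R : probability T R).

(* [K] will be an iterate of [Gamma], whose measurability is never needed. *)
Lemma le_Rintegral_subset (K : set R) (f g : R -> R) : K `<=` I ->
  (forall y, I y -> 0 <= g y <= 1) -> (forall y, K y -> 0 <= f y <= g y) ->
  \int[lambda]_(y in K) f y <= \int[lambda]_(y in I) g y.
Proof.
move=> KI g01 fg.
have g1 : (\int[lambda]_(y in I) (g y)%:E <= 1)%E.
  apply: (@le_trans _ _ (\int[lambda]_(y in I) (cst 1 y))%E).
    rewrite integral_mkcond [leRHS]integral_mkcond.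
    apply: ge0_le_integral_nonmeasurable => y; rewrite !patchE; case: ifPn => //;
      by rewrite inE => /g01/andP[]; rewrite !lee_fin.
  by rewrite integral_cst//= ?mul1e ?lambda_I01//; exact: measurable_I01.
have fg' : (\int[lambda]_(y in K) (f y)%:E <= \int[lambda]_(y in I) (g y)%:E)%E.
  rewrite integral_mkcond [leRHS]integral_mkcond.
  apply: ge0_le_integral_nonmeasurable => y; rewrite !patchE.
    by case: ifPn => //; rewrite inE => /fg/andP[]; rewrite lee_fin.
  case: ifPn => [|_]; last first.
    by case: ifPn => //; rewrite inE => /g01/andP[]; rewrite lee_fin.
  rewrite inE => Ky; rewrite ifT ?inE; last exact: KI.
  by have /andP[] := fg y Ky; rewrite lee_fin.
have f0 : (0 <= \int[lambda]_(y in K) (f y)%:E)%E.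
  by apply: integral_ge0 => y /fg/andP[]; rewrite lee_fin.
apply: fine_le => //.
- by rewrite ge0_fin_numE// (le_lt_trans fg')// (le_lt_trans g1)// ltry.
- by rewrite ge0_fin_numE ?(le_trans f0)// (le_lt_trans g1)// ltry.
Qed.

Lemma ae_unit_I : \forall x \ae P, I x.
Proof. by apply/ae_unitP; exact: aeW. Qed.

Variable W : R -> R -> R.
Hypothesis hW : graphon W.
Variable W' : T -> T -> R.
Hypothesis mW' : measurable_fun setT (fun z : T * T => W' z.1 z.2).
Hypothesis symW' : forall x y, W' x y = W' y x.
Hypothesis W'01 : forall x y, 0 <= W' x y <= 1.
Hypothesis W'0 : forall x y, ~ I y -> W' x y = 0.
Hypothesis WW' : \forall x \ae P, \forall y \ae P, W x y = W' x y.

Local Notation L := (kernel_op P W').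
Local Notation D := (kernel_deg P W').

Lemma kernel_op_graphon (f : R -> R) (F : T -> R) :
  P.-integrable setT (EFin \o F) -> (\forall y \ae P, f y = F y) ->
  \forall x \ae P, \int[lambda]_(y in I) (f y * W x y) = L F x.
Proof.
move=> Fi fF; apply: filterS WW' => x Wx.
rewrite /kernel_op Rintegral_unit; last by move=> y nI; rewrite W'0// mul0r.
apply: (complete_ae_eq_Rintegral completed_lebesgue_measure_is_complete).
- exact: measurable_I01.
- apply: measurable_funTS; apply: measurable_funM.
    exact: measurable_kernel_section.
  exact: measurable_integrable Fi.
- by apply/ae_unitP; apply: filterS2 fF Wx => y -> ->; rewrite mulrC.
Qed.

Lemma degree_graphon : \forall x \ae P, degree W x = D x.
Proof.
have : \forall y \ae P, (fun=> 1) y = (fun=> 1) y :> R by exact: aeW.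
move=> /(kernel_op_graphon (integrable_cstR P 1)).
rewrite -kernel_degE; apply: filterS => x <-.
by apply: eq_Rintegral => y _; rewrite mul1r.
Qed.

Let Gamma_sub (A : set R) eps k : A `<=` I -> iter k (Gamma W eps) A `<=` I.
Proof. by move=> AI; case: k => // k x []. Qed.

Hypothesis hdiam : finite_diameter W.

(** Finite diameter restated through measurable sets [E] that contain the iterates of [Gamma] up to
    a null set, which avoids measuring the iterates themselves. *)
Let reach (A : set R) : measurable (A : set T) -> A `<=` I -> (0 < lambda A)%E ->
  exists2 eps : R, 0 < eps & forall E : set R, measurable (E : set T) ->
    (\forall x \ae P, forall k, iter k (Gamma W eps) A x -> E x) ->
    \forall x \ae P, E x.
Proof.
have [N hN] := hdiam; move=> mA AI A0.
have [eps e0 h1] := hN A mA AI A0; exists eps => // E mE hE.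
apply: (ae_unit_of_full mE _ h1).
  by rewrite big_mkord -bigcup_mkord => x [k _]; exact: Gamma_sub.
apply: filterS hE => x hx; rewrite big_mkord -bigcup_mkord => -[k _].
exact: hx.
Qed.

(** Let [M] be the null set of points outside [A] that do see [A]. Any other point outside [A] has
    weight 0 to almost all of [A], hence lies below every positive threshold [eps]: the iterates of
    [Gamma] never leave the union of [A] and [M]. *)
Lemma graphon_connected : connected_kernel P W'.
Proof.
move=> A mA A0 hA; have [_ symW W01] := hW.
have mB : measurable (A `&` I : set T)  by exact: (measurableI _ _ mA (@measurable_I01 R)).
have [|//|eps e0 H] := reach mB; first by move=> x [].
apply: H => //.
have good : \forall x \ae P, ~ A x -> \forall y \ae P, A y -> W y x = 0.
  have := ae_unit_I; apply: filterS3 hA WW' => x h Wx Ix /h hx.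
  have := ae_unit_I; apply: filterS3 hx Wx => y h1 h2 Iy Ay.
  by rewrite symW// h2 h1.
have [M [mM M0 hM]] := (ae_unitP _).1 good.
have nM : \forall x \ae P, ~ M x.
  by apply/ae_unitP; exists M; split => // x /= /not_implyP[_ /contrapT].
have sub k : iter k (Gamma W eps) (A `&` I) `<=` A `|` M.
  elim: k => [|k IH] x /=; first by move=> [Ax _]; left.
  move=> [Ix ex].
  have [Ax|nAx] := pselect (A x); first by left.
  have [Mx|nMx] := pselect (M x); first by right.
  have gx : \forall y \ae P, A y -> W y x = 0.
    by apply: contrapT => h; apply: nMx; apply: hM => /= /(_ Ix nAx).
  exfalso; move: ex; apply/negP; rewrite -ltNge.
  set K := iter k _ _.
  (* A majorant on the fixed set containing the iterate [K]: it vanishes almost everywhere, so its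
     integral is 0 whatever the measurability of [K]. *)
  pose g y := if y \in (A `|` M) then W y x else 0.
  apply: (@le_lt_trans _ _ (\int[lambda]_(y in I) g y)).
    apply: le_Rintegral_subset.
    - by apply: Gamma_sub => y [].
    - by move=> y Iy; rewrite /g; case: ifP; rewrite ?lexx ?ler01 ?W01.
    - move=> y Ky; have Iy : I y by apply: Gamma_sub Ky => z [].
      rewrite /g ifT ?inE; last exact: IH.
      by rewrite lexx andbT; have /andP[] := W01 y x Iy Ix.
  rewrite (@complete_ae_eq_Rintegral _ _ _ lambda _ _ (fun=> 0)) ?Rintegral_cst ?mul0r//.
  - exact: measurable_I01.
  - exact: completed_lebesgue_measure_is_complete.
  - exact: measurable_I01.
  - apply/ae_unitP; apply: filterS2 gx nM => y gy nMy; rewrite /g.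
    by case: ifPn => //; rewrite inE => -[/gy|].
by apply: filterS nM => x nMx k /sub[|/nMx].
Qed.

(** A point reached from [A] after at least one step has degree at least [eps], but nothing is
    learnt about points of [A]. Two disjoint halves of the interval as starting sets cover almost
    every point. *)
Lemma degree_lower_bound : exists2 delta : R, 0 < delta &
  \forall x \ae P, delta <= D x.
Proof.
have [_ symW W01] := hW.
have half (A : set R) : measurable (A : set T) -> A `<=` I -> (0 < lambda A)%E ->
    exists2 eps : R, 0 < eps & \forall x \ae P, A x \/ eps <= D x.
  move=> mA AI A0; have [eps e0 H] := reach mA AI A0; exists eps => //.
  apply: (H (A `|` [set x | eps <= D x])).
    apply: measurableU => //; rewrite -[X in measurable X]setTI.
    have := measurable_kernel_deg P mW' W'01.
    rewrite (_ : [set x | eps <= D x] = D @^-1` `[eps, +oo[).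
      by move=> /(_ measurableT); apply; exact: measurable_itv.
    by apply/seteqP; split => x; rewrite /= in_itv/= andbT.
  apply: filterS degree_graphon => x Dx [|k]; first by left.
  move=> [Ix ex]; right; rewrite /= -Dx; apply: le_trans ex _.
  apply: le_Rintegral_subset.
  - exact: Gamma_sub.
  - by move=> y Iy; exact: W01.
  - move=> y Ky; have Iy : I y by apply: Gamma_sub Ky.
    by rewrite symW// lexx andbT; have /andP[] := W01 x y Ix Iy.
have mitv (i : interval R) : measurable ([set` i] : set T).
  by apply: borel_lebesgue; exact: measurable_itv.
have [|||e1 e10 h1] := half `[0, 2^-1]%classic.
- exact: mitv.
- by move=> x; rewrite /I01 /= !in_itv/= => /andP[-> h]; lra.
- rewrite [ltRHS](_ : _ = lebesgue_measure (`[0, 2^-1]%classic : set R))//.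
  by rewrite lebesgue_measure_itv/= lte_fin invr_gt0 ltr0n oppr0 adde0 lte_fin invr_gt0.
have [|||e2 e20 h2] := half `]2^-1, 1]%classic.
- exact: mitv.
- by move=> x; rewrite /I01 /= !in_itv/= => /andP[h ->]; rewrite andbT; lra.
- rewrite [ltRHS](_ : _ = lebesgue_measure (`]2^-1, 1]%classic : set R))//.
  have h : 2^-1 < 1 :> R by lra.
  by rewrite lebesgue_measure_itv/= lte_fin h -EFinD lte_fin subr_gt0.
exists (Num.min e1 e2); first by rewrite lt_min e10.
apply: filterS2 h1 h2 => x [x1|]; last by move=> h _; rewrite ge_min h.
case=> [x2|h]; last by rewrite ge_min h orbT.
by move: x1 x2; rewrite /= !in_itv/= => /andP[_ ?] /andP[? _]; lra.
Qed.

Variables (delta : R) (sigma : R -> R) (s : T -> R).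
Hypothesis delta0 : 0 < delta.
Hypothesis degW' : \forall x \ae P, delta <= D x.
Hypothesis s0 : forall x, 0 <= s x.
Hypothesis si : P.-integrable setT (EFin \o s).
Hypothesis sigma_s : \forall x \ae P, sigma x = s x.

Local Notation u := (odo P W' delta s).

(** Dividing [chips n] by the degree gives the argument of the floor in [odo n.+1] minus the integer
    [u n x], which leaves the floor unchanged. *)
Lemma firing_graphon n (tau : R -> R) :
  (\forall x \ae P, tau x = chips P W' delta s n x) ->
  \forall x \ae P, firing W tau x = u n.+1 x - u n x.
Proof.
move=> htau; have hD := deg_floor_ae degW'.
apply: filterS3 degree_graphon htau hD => x degx taux Ddx.
have Dd0 := deg_floor_gt0 P W' delta0 x.
have un : - u n x \is a Num.int by rewrite rpredN; exact: odo_int.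
rewrite /firing degx -Ddx Dd0 taux /chips -Ddx mulrBl (mulrC _ (u n x)).
rewrite mulfK ?gt_eqF// floorDrz// intrD; congr (_ + _).
by apply/eqP; rewrite -intrEfloor.
Qed.

(** By induction the firing vector is almost everywhere an increment of [u], and linearity of [L]
    advances the closed form by one step. *)
Lemma update_graphon n :
  \forall x \ae P, iter n (update W) sigma x = chips P W' delta s n x.
Proof.
elim: n => [|n IH].
  apply: filterS sigma_s => x /= ->.
  by rewrite /chips /= kernel_op_cst// mul0r mulr0 subr0 addr0.
have fn := firing_graphon IH.
have un := integrable_odo mW' W'01 delta0 s0 si n.
have un1 := integrable_odo mW' W'01 delta0 s0 si n.+1.
have Fi := integrable_EFinB un1 un.
have hL := kernel_op_graphon Fi fn.
have fd : \forall x \ae P, firing W (iter n (update W) sigma) x = u n.+1 x - u n x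
    /\ degree W x = D x.
  by apply: filterS2 fn degree_graphon.
apply: filterS3 IH hL fd => x IHx Lx [fx degx].
rewrite [LHS]/= /update IHx Lx degx fx kernel_opB// /chips.
ring.
Qed.

Lemma odometer_graphon n : \forall x \ae P, odometer W sigma n x = u n x.
Proof.
elim: n => [|n IH].
  by apply: aeW => x; rewrite /odometer big_geq.
apply: filterS2 IH (firing_graphon (update_graphon n)) => x IHx fx.
by rewrite /odometer big_nat_recr//= -/(odometer W sigma n x) IHx fx addrC subrK.
Qed.

End graphon_activity.

Theorem theorem4p11 (R : realType) (W : R -> R -> R)
    (hW : graphon W) (hdiam : finite_diameter W) :
  forall sigma : R -> R, chip_config sigma ->
    exists a : R, is_activity W sigma a.
Proof.
move=> sigma [isigma sigma0].
have [W' [mW' symW' W'01 W'0 /ae_unitP hWW']] := graphon_borel hW.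
have WW' : \forall x \ae (@unit_lebesgue R), \forall y \ae (@unit_lebesgue R),
    W x y = W' x y.
  by apply: filterS hWW' => x /ae_unitP.
have [delta delta0 degW'] := degree_lower_bound hW mW' W'01 W'0 WW' hdiam.
have conn := graphon_connected hW WW' hdiam.
have mI := @measurable_I01 R.
(* Clipping at 0 and extending by 0 gives a representative of [sigma] that is non-negative
   everywhere, as the odometer recursion requires. *)
pose s : lebesgue_line R -> R :=
  (fun x : lebesgue_line R => Num.max (sigma x) 0) \_ (@I01 R).
have s0 x : 0 <= s x by rewrite /s patchE; case: ifP; rewrite // le_max lexx orbT.
have msigma : measurable_fun (@I01 R : set (lebesgue_line R)) sigma.
  exact/measurable_EFinP/(measurable_int _ isigma).
have ms : measurable_fun setT s.
  apply: (measurable_restrictT _ mI).1.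
  exact: measurable_maxr.
have si : (@unit_lebesgue R).-integrable setT (EFin \o s).
  apply/integrableP; split; first exact/measurable_EFinP.
  rewrite integral_unit; last first.
    by move=> x nI; rewrite /= /s patchE ifF ?normr0//; apply/negP; rewrite inE.
  have /integrableP[_] := isigma; apply: le_lt_trans.
  apply: ge0_le_integral => //.
  - by apply: measurableT_comp => //; apply: measurable_funTS; exact/measurable_EFinP.
  - by apply: measurableT_comp => //; exact/measurable_EFinP.
  - move=> x Ix; rewrite /= /s patchE ifT ?inE// lee_fin.
    by rewrite ger0_norm ?le_max ?lexx ?orbT// ge_max ler_norm normr_ge0.
have sigma_s : \forall x \ae (@unit_lebesgue R), sigma x = s x.
  apply/ae_unitP; apply: filterS sigma0 => x sx Ix.
  by rewrite /s patchE ifT ?inE//; apply/esym/max_idPl; exact: sx.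
have [a ha] := odo_activity mW' symW' W'01 delta0 degW' s0 si conn.
exists a; apply/ae_unitP.
(* One null set serves all [n], so the two sequences agree at almost every point before the limit is
   taken. *)
have := ae_foralln (odometer_graphon mW' W'01 W'0 WW' delta0 degW' s0 si sigma_s).
apply: filterS2 ha => x hx hodo.
by under eq_cvg do rewrite hodo.
Qed.
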